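(* For every finite connected simple graph $G$ with at least one edge, $$D_r(L(G))\le D_r(G),$$ with equality if and only if $G\cong C_n$ for some $n\ge 3$ or $G\cong K_4$.
   Context: The line graph $L(G)$ of a graph $G$ has vertex set $E(G)$, two vertices of $L(G)$ being adjacent whenever the corresponding (distinct) edges of $G$ have a common endpoint. For a connected graph $G$, $R_G(x,y)$ denotes the effective resistance between vertices $x$ and $y$ when every edge of $G$ is replaced by a unit resistor. The resistance diameter of $G$ is $D_r(G)=\max_{x,y\in V(G)}R_G(x,y)$, where $x=y$ is allowed (so the one-vertex graph has resistance diameter $0$). $C_n$ is the cycle on $n$ vertices and $K_4$ the complete graph on four vertices. *)

(* Defs.v *)
From mathcomp Require Import all_boot all_order all_algebra.
From mathcomp Require Import boolp classical_sets reals.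

Set Implicit Arguments.
Unset Strict Implicit.
Unset Printing Implicit Defensive.

Import Order.TTheory GRing.Theory Num.Theory.
Local Open Scope ring_scope.

Record sgraph := SGraph {
  vertex :> finType;
  adj : rel vertex;
  adj_sym : symmetric adj;
  adj_irrefl : irreflexive adj
}.

Definition connected_graph (G : sgraph) : Prop :=
  forall x y : G, connect (@adj G) x y.

Definition edges (G : sgraph) : {set {set G}} :=
  [set [set p.1; p.2]%SET | p : G * G & adj p.1 p.2]%SET.

Definition isomorphic (G H : sgraph) : Prop :=
  exists f : G -> H, bijective f /\ forall x y, adj (f x) (f y) = adj x y.

Section LineGraph.
Variable G : sgraph.

Definition line_vertex : finType := {E : {set G} | E \in edges G}.

Definition line_adj (a b : line_vertex) : bool :=
  (a != b) && ~~ [disjoint val a & val b].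

Lemma line_adj_sym : symmetric line_adj.
Proof. by move=> a b; rewrite /line_adj eq_sym disjoint_sym. Qed.

Lemma line_adj_irrefl : irreflexive line_adj.
Proof. by move=> a; rewrite /line_adj eqxx. Qed.

Definition line_graph : sgraph := SGraph line_adj_sym line_adj_irrefl.

End LineGraph.

Section CycleComplete.
Variable n : nat.

(* The conjunct i != j only matters for n = 1, where C_n would be a loop;
   this is the n-vertex cycle exactly when 3 <= n. *)
Definition cycle_adj (i j : 'I_n) : bool :=
  (i != j) && ((j == i.+1 %% n :> nat) || (i == j.+1 %% n :> nat))%N.

Lemma cycle_adj_sym : symmetric cycle_adj.
Proof. by move=> i j; rewrite /cycle_adj eq_sym orbC. Qed.

Lemma cycle_adj_irrefl : irreflexive cycle_adj.
Proof. by move=> i; rewrite /cycle_adj eqxx. Qed.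

Definition cycle_graph : sgraph := SGraph cycle_adj_sym cycle_adj_irrefl.

Definition complete_adj (i j : 'I_n) : bool := i != j.

Lemma complete_adj_sym : symmetric complete_adj.
Proof. by move=> i j; rewrite /complete_adj eq_sym. Qed.

Lemma complete_adj_irrefl : irreflexive complete_adj.
Proof. by move=> i; rewrite /complete_adj eqxx. Qed.

Definition complete_graph : sgraph :=
  SGraph complete_adj_sym complete_adj_irrefl.

End CycleComplete.

Section Resistance.
Variables (R : realType) (G : sgraph).

(* Ohm's law makes v z - v w the current from z to w along a unit resistor;
   Kirchhoff's law then says that one unit of current enters the network at x
   and leaves it at y. *)
Definition unit_current_potential (x y : G) (v : G -> R) : Prop :=
  forall z, \sum_(w | adj z w) (v z - v w) = (z == x)%:R - (z == y)%:R.

(* xget selects an element of the given set (0 if it is empty); for connected G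
   the set is a singleton, see eff_res_potential. *)
Definition eff_res (x y : G) : R :=
  xget 0 [set r | exists2 v, unit_current_potential x y v & r = v x - v y]%classic.

(* The seed 0 is harmless: it is the value of eff_res x x, see res_diam_attained. *)
Definition res_diam : R :=
  \big[Num.max/0]_(x : G) \big[Num.max/0]_(y : G) eff_res x y.

Lemma harmonic_const (v : G -> R) : connected_graph G ->
  (forall z, \sum_(w | adj z w) (v z - v w) = 0) -> forall x y, v x = v y.
Proof.
move=> Gc hv x0.
have [m _ mmax] := @Order.TotalTheory.arg_maxP _ _ G x0 predT v isT.
suff key y : v y = v m by move=> y; rewrite !key.
have cl : closed (@adj G) [pred z | v z == v m].
  apply: intro_closed => [|a b eab].
    by apply: sym_connect_sym; exact: adj_sym.
  rewrite !inE => /eqP va.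
  have /eqP := hv a; rewrite psumr_eq0 => [|w _]; last first.
    by rewrite va subr_ge0; exact: mmax.
  by move=> /allP /(_ b (mem_index_enum _)); rewrite eab subr_eq0 va eq_sym.
have := closed_connect cl (Gc m y).
by rewrite !inE eqxx => /esym /eqP.
Qed.

Lemma potential_exists (x y : G) : connected_graph G ->
  exists v, unit_current_potential x y v.
Proof.
move=> Gc.
pose f (c : G -> R) z := \sum_(w | adj z w) (c z - c w).
pose L : 'M[R]_#|G| := \matrix_(i, j)
  f (fun w => (w == enum_val j)%:R) (enum_val i).
have LE (c : 'I_#|G| -> R) i :
    \sum_j L i j * c j = f (fun w => c (enum_rank w)) (enum_val i).
  under eq_bigr do rewrite mxE mulr_suml.
  rewrite exchange_big; apply: eq_bigr => w _ /=.
  under eq_bigr do rewrite mulrBl.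
  have pick u : \sum_j (u == enum_val j)%:R * c j = c (enum_rank u).
    rewrite (bigD1 (enum_rank u)) //= enum_rankK eqxx mul1r big1 ?addr0 // => j ju.
    rewrite (_ : _ == _ = false) ?mul0r //; apply: contraNF ju => /eqP ->.
    by rewrite enum_valK.
  by rewrite sumrB !pick enum_valK.
have Lsym i j : L i j = L j i.
  have F a b : f (fun w => (w == b)%:R) a
      = (a == b)%:R * #|@adj G a|%:R - (adj a b)%:R.
    rewrite /f sumrB sumr_const mulr_natr; congr (_ - _).
    have [ab|ab] := boolP (adj a b).
      by rewrite (bigD1 b) //= eqxx big1 ?addr0 // => w /andP[_ /negPf ->].
    rewrite big1 // => w aw; case: eqP => // wb.
    by rewrite -wb aw in ab.
  rewrite !mxE !F adj_sym eq_sym; case: eqP => [->//|_]; by rewrite !mul0r.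
pose b : 'rV[R]_#|G| :=
  \row_j ((enum_val j == x)%:R - (enum_val j == y)%:R).
have : (b <= L)%MS.
  rewrite submxE; apply/eqP/rowP => k; rewrite !mxE.
  have cst j1 j2 : cokermx L j1 k = cokermx L j2 k.
    have := @harmonic_const (fun w => cokermx L (enum_rank w) k) Gc.
    move=> /(_ _ (enum_val j1) (enum_val j2)); rewrite !enum_valK; apply => z.
    have /matrixP/(_ (enum_rank z) k) := mulmx_coker L.
    rewrite mxE [RHS]mxE => Lc.
    by rewrite -[RHS]Lc (LE (fun j => cokermx L j k)) enum_rankK.
  rewrite (eq_bigr (fun j => b 0 j * cokermx L (enum_rank x) k)); last first.
    by move=> j _; rewrite (cst j (enum_rank x)).
  rewrite -mulr_suml (_ : \sum_i _ = 0) ?mul0r //.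
  under eq_bigr do rewrite mxE.
  have one u : \sum_(i < #|G|) (enum_val i == u)%:R = 1 :> R.
    rewrite (bigD1 (enum_rank u)) //= enum_rankK eqxx big1 ?addr0 // => j ju.
    rewrite (_ : _ == _ = false) //; apply: contraNF ju => /eqP <-.
    by rewrite enum_valK.
  by rewrite sumrB !one subrr.
move=> /submxP[D bD].
exists (fun w => D 0 (enum_rank w)) => z.
move/rowP: bD => /(_ (enum_rank z)); rewrite !mxE enum_rankK => ->.
have := LE (fun j => D 0 j) (enum_rank z); rewrite /f enum_rankK => <-.
by apply: eq_bigr => j _; rewrite mulrC Lsym.
Qed.

Lemma eff_res_potential (x y : G) (v : G -> R) : connected_graph G ->
  unit_current_potential x y v -> eff_res x y = v x - v y.
Proof.
move=> Gc hv; rewrite /eff_res.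
case: xgetP => [r _ [u hu ->]|/(_ (v x - v y))]; last first.
  by move=> []; exists v.
have h : u x - v x = u y - v y.
  apply: (@harmonic_const (fun z => u z - v z) Gc) => z.
  rewrite (eq_bigr (fun w => (u z - u w) - (v z - v w))) => [|w _].
    by rewrite sumrB hu hv subrr.
  by rewrite [in LHS]opprB [v w - u w]addrC addrACA [in RHS]opprB [v w - _]addrC.
have -> : u x = u y - v y + v x by rewrite -h subrK.
by rewrite addrC !addrA addNr add0r addrC.
Qed.

Lemma eff_res_xx (x : G) : connected_graph G -> eff_res x x = 0.
Proof.
move=> Gc; rewrite (@eff_res_potential x x (fun=> 0)) ?subrr // => z.
by rewrite [RHS]subrr big1 // => w _; rewrite subrr.
Qed.

Lemma eff_res_le_diam (x y : G) : eff_res x y <= res_diam.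
Proof.
apply: le_trans (le_bigmax _ _ x); exact: (le_bigmax _ (eff_res x) y).
Qed.

Lemma res_diam_attained (x0 : G) : connected_graph G ->
  exists x y, res_diam = eff_res x y.
Proof.
move=> Gc.
have z0 : exists x y : G, 0 = eff_res x y by exists x0, x0; rewrite eff_res_xx.
rewrite /res_diam; elim/big_ind: _ => // [a b ha hb|x _].
  by case: (leP a b).
elim/big_ind: _ => // [a b ha hb|y _]; first by case: (leP a b).
by exists x, y.
Qed.

End Resistance.

(* Main.v *)
Require Import Defs.
From mathcomp Require Import all_boot all_order all_algebra.
From mathcomp Require Import boolp reals.
From mathcomp Require Import ring lra zify.

Set Implicit Arguments.
Unset Strict Implicit.
Unset Printing Implicit Defensive.

Import Order.TTheory GRing.Theory Num.Theory.
Local Open Scope ring_scope.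

(** A clique on d vertices with unit resistors is equivalent to a star whose legs
    have resistance 1/d. In the line graph every vertex x of G contributes a
    clique on deg x vertices, so the line graph behaves like the subdivision of G
    in which each half-edge at x has resistance 1/deg x; the vertices of the line
    graph are the midpoints of the edges of G. In G itself half-edges have
    resistance 1/2. Fix two edges e = uv and f = wz and let i be the current from
    the midpoint of e to the midpoint of f in the subdivision of G. Its energy in
    the line graph bounds the resistance between e and f there (line_res_le), and
    the change from 1/2 to 1/deg x saves
      gain i = sum over x of (1/2 - 1/deg x) * (sum of i^2 on the half-edges at x),
    in which every term is nonnegative: leaves carry no current.

    On the other side, moving from the midpoints to the ends of e and f has a
    price. Write w_e for the projection of the unit current along e on the space
    of circulations and K_e for its energy, which is one minus the resistance
    between u and v. Averaging the four resistances between an end of e and an end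
    of f costs (K_e + K_f)/4; averaging over one pairing of the ends costs a
    quarter of the energy of w_e - w_f, for the orientation given by the pairing
    (compare_pairing). A lopsided current gives a bonus (compare_drop_uv and
    compare_drop_wz). So the inequality follows once 4 * gain i exceeds one of
    these costs.

    If e is a bridge, then all the current crosses it in one direction and the
    bonus exceeds every cost (acyclic_strict). If all circulations agree on e and
    f up to sign, which happens when e and f lie on one chain of vertices of
    degree 2, the pairing costs nothing (parallel_gain). Equality then means that
    the current avoids all vertices of degree other than 2, and G is a cycle
    (no_gain_cycle).

    Otherwise walk away from e and f in both directions through vertices of degree
    2. Currents and circulations do not change on the way, and each of the four
    walks ends at a vertex of degree at least 3 (chain_end_exists). There the
    current i, which has to split, produces gain, while a circulation has to
    spread over further edges, which bounds its value on e by its energy. Both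
    effects are governed by the same numbers. If e and f have no common end, then
    K_e <= 4 * (gain at the ends of e), and similarly for f (edge_gain). If
    they have a common end P, then orient e and f so that the pairing makes
    w_e - w_f enter P along both chains. The edges at P that are left have to
    carry the sum of the two currents, and a strict inequality results
    (meet_strict). So equality can occur only without common ends. It forces the
    ends of e and of f to have degree 3 and common neighbours (single_tight), and
    these neighbours must be the ends of the other edge, as they would add to the
    gain otherwise (disjoint_le): the graph is K_4.

    Conversely a cycle is isomorphic to its line graph, and for K_4 both diameters
    are 1/2. *)

(** * Sums of squares *)

Section SumSquares.
Variables (R : realType) (T : finType).
Implicit Types (P : pred T) (f : T -> R).

Lemma sum_sqr_ge0 P f : 0 <= \sum_(i | P i) f i ^+ 2.
Proof. by apply: sumr_ge0 => i _; exact: sqr_ge0. Qed.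

Lemma sqr_sum_le_card P f :
  (\sum_(i | P i) f i) ^+ 2 <= #|P|%:R * \sum_(i | P i) f i ^+ 2.
Proof.
set S := \sum_(i | P i) f i; set n : R := #|P|%:R.
have [n0|n_gt0] := posnP #|P|.
  have P0 : P =1 pred0 by apply/pred0P; rewrite /pred0b n0.
  by rewrite /S !(eq_bigl _ _ P0) !big_pred0_eq mulr0 expr0n.
have : 0 <= \sum_(i | P i) (n * f i - S) ^+ 2 by exact: sum_sqr_ge0.
have -> : \sum_(i | P i) (n * f i - S) ^+ 2
    = n * (n * (\sum_(i | P i) f i ^+ 2) - S ^+ 2).
  rewrite (eq_bigr (fun i => n ^+ 2 * f i ^+ 2 + - (2 * n * S) * f i + S ^+ 2)).
    by rewrite !big_split /= -!mulr_sumr sumr_const -mulr_natl -/S -/n; ring.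
  by move=> i _; ring.
by rewrite pmulr_rge0 ?subr_ge0 // ltr0n.
Qed.

End SumSquares.

(** * Flows and potentials *)

Section Network.
Variables (R : realType) (G : sgraph).
Implicit Types (x y u v w z : G) (p q : G -> R) (om F : G -> G -> R).

Definition deg x := #|@adj G x|.

Definition laplacian p z := \sum_(w | adj z w) (p z - p w).

Definition dart_sum F := \sum_x \sum_(y | adj x y) F x y.

Lemma dart_sum_rev F : dart_sum F = dart_sum (fun x y => F y x).
Proof.
rewrite /dart_sum (exchange_big_dep predT) //=; apply: eq_bigr => y _.
by apply: eq_bigl => x; rewrite adj_sym.
Qed.

Lemma eq_dart_sum F1 F2 :
  (forall x y, adj x y -> F1 x y = F2 x y) -> dart_sum F1 = dart_sum F2.
Proof. by move=> e; apply: eq_bigr => x _; apply: eq_bigr => y /e. Qed.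

Lemma dart_sumD F1 F2 :
  dart_sum (fun x y => F1 x y + F2 x y) = dart_sum F1 + dart_sum F2.
Proof. by rewrite /dart_sum -big_split; apply: eq_bigr => x _; rewrite big_split. Qed.

Lemma dart_sumZ a F : dart_sum (fun x y => a * F x y) = a * dart_sum F.
Proof.
by rewrite /dart_sum mulr_sumr; apply: eq_bigr => x _; rewrite mulr_sumr.
Qed.

Lemma dart_sum_delta u v F : adj u v ->
  dart_sum (fun x y => F x y * ((x == u) && (y == v))%:R) = F u v.
Proof.
move=> uv; rewrite /dart_sum (bigD1 u) //= (bigD1 v) //= !eqxx mulr1.
rewrite !big1 ?addr0 // => x.
  by move=> /negPf xu; apply: big1 => y _; rewrite xu mulr0.
by move=> /andP[_ /negPf ->]; rewrite andbF mulr0.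
Qed.

(** Summation by parts for an antisymmetric function. *)
Lemma dart_sum_grad p om : (forall x y, adj x y -> om y x = - om x y) ->
  dart_sum (fun x y => (p x - p y) * om x y)
  = 2 * \sum_x p x * \sum_(y | adj x y) om x y.
Proof.
move=> omN.
rewrite (eq_dart_sum (F2 := fun x y => p x * om x y + p y * om y x)); last first.
  by move=> x y xy; rewrite (omN x y xy); ring.
rewrite dart_sumD [X in _ + X]dart_sum_rev mulr_natl mulr2n.
by congr (_ + _); apply: eq_bigr => x _; rewrite mulr_sumr.
Qed.

Lemma green p q : \sum_z p z * laplacian q z = \sum_z q z * laplacian p z.
Proof.
have g (a b : G -> R) :
    dart_sum (fun x y => (a x - a y) * (b x - b y)) = 2 * \sum_x a x * laplacian b x.
  by rewrite dart_sum_grad // => x y _; rewrite opprB.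
have : 2 * (\sum_z p z * laplacian q z) = 2 * \sum_z q z * laplacian p z.
  by rewrite -!g; apply: eq_dart_sum => x y _; rewrite mulrC.
by lra.
Qed.

Lemma sum_delta p u : \sum_x p x * (x == u)%:R = p u.
Proof.
rewrite (bigD1 u) //= eqxx mulr1 big1 ?addr0 // => x /negPf ->.
by rewrite mulr0.
Qed.

Lemma sum_adj_delta u v x : adj u v ->
  \sum_(y | adj x y) ((x == u) && (y == v))%:R = (x == u)%:R :> R.
Proof.
move=> uv; case: eqP => [->|_] /=; last by rewrite big1.
by rewrite (bigD1 v) //= eqxx big1 ?addr0 // => y /andP[_ /negPf ->].
Qed.

Lemma green_unit p u v q : unit_current_potential u v q ->
  \sum_z q z * laplacian p z = p u - p v.
Proof.
move=> hq; rewrite green (eq_bigr (fun z => p z * (z == u)%:R - p z * (z == v)%:R)).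
  by rewrite sumrB !sum_delta.
by move=> z _; rewrite /laplacian hq mulrBr.
Qed.

Definition circulation om :=
  (forall x y, om y x = - om x y) /\ forall x, \sum_(y | adj x y) om x y = 0.

Definition sqr_at om x := \sum_(y | adj x y) om x y ^+ 2.

Definition energy om := (\sum_x sqr_at om x) / 2.

Lemma sqr_at_ge0 om x : 0 <= sqr_at om x. Proof. exact: sum_sqr_ge0. Qed.

Lemma energy_ge0 om : 0 <= energy om.
Proof. by apply: divr_ge0 => //; apply: sumr_ge0 => x _; exact: sqr_at_ge0. Qed.

(** The projection of the edge uv onto the cycle space: the unit current along
    uv minus the current that the potential a drives from u to v. *)
Definition edge_cycle u v a x y : R :=
  ((x == u) && (y == v))%:R - ((x == v) && (y == u))%:R - (a x - a y).

Lemma edge_cycle_circulation u v a : adj u v ->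
  unit_current_potential u v a -> circulation (edge_cycle u v a).
Proof.
move=> uv ha; split=> [x y|x].
  by rewrite /edge_cycle [(y == u) && _]andbC [(y == v) && _]andbC; ring.
rewrite /edge_cycle sumrB ha sumrB.
by rewrite !sum_adj_delta ?subrr // adj_sym.
Qed.

Lemma circulation_pairing om u v a : adj u v -> circulation om ->
  dart_sum (fun x y => om x y * edge_cycle u v a x y) = 2 * om u v.
Proof.
move=> uv [omN om0].
have vu : adj v u by rewrite adj_sym.
rewrite (eq_dart_sum (F2 := fun x y =>
   (om x y * ((x == u) && (y == v))%:R + (-1) * (om x y * ((x == v) && (y == u))%:R))
   + (-1) * ((a x - a y) * om x y))); last first.
  by move=> x y _; rewrite /edge_cycle; ring.
rewrite !dart_sumD !dart_sumZ !dart_sum_delta // dart_sum_grad //.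
rewrite big1 => [|x _]; last by rewrite om0 mulr0.
by rewrite (omN u v); ring.
Qed.

Lemma energyE om : energy om = dart_sum (fun x y => om x y * om x y) / 2.
Proof. by congr (_ / 2); apply: eq_bigr => x _; apply: eq_bigr => y _; rewrite expr2. Qed.

(** Orthogonality of circulations and gradients: the norm of a projected edge is
    its own value on that edge. *)
Lemma energy_edge_cycle u v a : adj u v -> unit_current_potential u v a ->
  energy (edge_cycle u v a) = edge_cycle u v a u v.
Proof.
move=> uv ha; rewrite energyE circulation_pairing //; first by field.
exact: edge_cycle_circulation.
Qed.

Lemma circulationB om1 om2 : circulation om1 -> circulation om2 ->
  circulation (fun x y => om1 x y - om2 x y).
Proof.
move=> [a1 b1] [a2 b2]; split=> [x y|x]; first by rewrite a1 a2; ring.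
by rewrite sumrB b1 b2 subrr.
Qed.

Lemma energyB u v a w z b : adj u v -> adj w z ->
  unit_current_potential u v a -> unit_current_potential w z b ->
  let om x y := edge_cycle u v a x y - edge_cycle w z b x y in
  energy om = om u v - om w z.
Proof.
move=> uv wz ha hb om.
have co : circulation om by apply: circulationB; exact: edge_cycle_circulation.
rewrite energyE (eq_dart_sum (F2 := fun x y => om x y * edge_cycle u v a x y
   + (-1) * (om x y * edge_cycle w z b x y))); last first.
  by move=> x y _; rewrite /om; ring.
by rewrite dart_sumD dart_sumZ !circulation_pairing //; field.
Qed.

Definition del_at x om y z : R := if (y == x) || (z == x) then 0 else om y z.

(** Peeling off the edges at one vertex after the other bounds energies below
    without counting an edge twice. *)
Lemma energy_del x om : (forall y z, om z y = - om y z) ->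
  energy om = sqr_at om x + energy (del_at x om).
Proof.
move=> omN.
have split2 y : sqr_at om y = sqr_at (del_at x om) y
    + ((y == x)%:R * sqr_at om x + (y != x)%:R * ((adj y x)%:R * om y x ^+ 2)).
  rewrite /sqr_at; case: (eqVneq y x) => [->|yx].
    rewrite [X in _ = X + _]big1 => [|z _]; last first.
      by rewrite /del_at eqxx expr0n.
    by rewrite /= mul1r mul0r addr0 add0r.
  rewrite mul0r mul1r add0r; case yax: (adj y x); last first.
    rewrite mul0r addr0; apply: eq_bigr => z yz.
    rewrite /del_at (negPf yx) /=; case: eqP => // zx.
    by rewrite -zx yz in yax.
  rewrite mul1r (bigD1 x) //= [in RHS](bigD1 x) //= addrC; congr (_ + _).
  rewrite {1}/del_at eqxx orbT expr0n add0r; apply: eq_bigr => z /andP[_ zx].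
  by rewrite /del_at (negPf yx) (negPf zx).
have dl : \sum_y (y != x)%:R * ((adj y x)%:R * om y x ^+ 2) = sqr_at om x.
  rewrite /sqr_at [RHS]big_mkcond /=; apply: eq_bigr => y _.
  rewrite adj_sym omN sqrrN; case xy : (adj x y); last by rewrite mul0r mulr0.
  by case: eqVneq => [yx|_]; rewrite ?mul1r //; rewrite yx adj_irrefl in xy.
have dr : \sum_y (y == x)%:R * sqr_at om x = sqr_at om x.
  rewrite (bigD1 x) //= eqxx mul1r big1 ?addr0 // => y /negPf ->.
  by rewrite mul0r.
by rewrite /energy (eq_bigr _ (fun y _ => split2 y)) !big_split /= dl dr; field.
Qed.

Lemma del_atN x om : (forall y z, om z y = - om y z) ->
  forall y z, del_at x om z y = - del_at x om y z.
Proof.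
by move=> omN y z; rewrite /del_at orbC; case: ifP => _; rewrite ?oppr0 // omN.
Qed.

Lemma energy_ge_sqr_at om x : (forall y z, om z y = - om y z) ->
  sqr_at om x <= energy om.
Proof. by move=> omN; rewrite (energy_del x) // lerDl energy_ge0. Qed.

Lemma sqr_at_ge om x y : adj x y -> om x y ^+ 2 <= sqr_at om x.
Proof. by move=> xy; rewrite /sqr_at (bigD1 y) //= lerDl sum_sqr_ge0. Qed.

Lemma energy_le0 om x y : (forall y z, om z y = - om y z) -> energy om <= 0 ->
  adj x y -> om x y = 0.
Proof.
move=> omN E0 xy; apply/eqP; rewrite -sqrf_eq0 eq_le sqr_ge0 andbT.
by apply: le_trans E0; apply: le_trans (energy_ge_sqr_at x omN); exact: sqr_at_ge.
Qed.

End Network.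

(** * The line graph as a network of stars *)

Section LineGraphEdges.
Variable G : sgraph.
Implicit Types x y u v w z : G.

Lemma set2_eq (T : finType) (x y u v : T) : [set x; y]%SET = [set u; v]%SET ->
  (x = u /\ y = v) \/ (x = v /\ y = u).
Proof.
move=> e.
have /set2P[xu|xv] : x \in [set u; v]%SET by rewrite -e set21.
  have /set2P[yu|yv] : y \in [set u; v]%SET by rewrite -e set22.
    have : v \in [set x; y]%SET by rewrite e set22.
    by rewrite xu yu => /set2P[]->; left.
  by left.
have /set2P[yu|yv] : y \in [set u; v]%SET by rewrite -e set22.
  by right.
have : u \in [set x; y]%SET by rewrite e set21.
by rewrite xv yv => /set2P[]->; left.
Qed.

Lemma mem_edges x y : ([set x; y]%SET \in edges G) = adj x y.
Proof.
apply/imsetP/idP => [[[a b]]|xy]; last by exists (x, y); rewrite // inE.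
rewrite inE /= => ab /set2_eq[[-> ->]|[-> ->]] //.
by rewrite adj_sym.
Qed.

Lemma line_vertexP (g : line_vertex G) : exists x y, adj x y /\ val g = [set x; y]%SET.
Proof.
have := valP g => /imsetP[[a b]]; rewrite inE /= => ab eg.
by exists a, b.
Qed.

Lemma edge_vertex x y : adj x y -> exists g : line_vertex G, val g = [set x; y]%SET.
Proof. by rewrite -mem_edges => xy; exists (exist (fun S => S \in edges G) _ xy). Qed.

Lemma adj_neq x y : adj x y -> x != y.
Proof. by apply: contraTneq => ->; rewrite adj_irrefl. Qed.

Lemma line_adj_common (g h : line_vertex G) x :
  g != h -> x \in val g -> x \in val h -> line_adj g h.
Proof.
move=> gh xg xh; rewrite /line_adj gh /=; apply/negP.
by move=> /pred0P/(_ x); rewrite /= xg xh.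
Qed.

Lemma connect_common (g h : line_vertex G) x :
  x \in val g -> x \in val h -> connect (@line_adj G) g h.
Proof.
have [->|gh] := eqVneq g h; first by rewrite connect0.
by move=> xg xh; apply: connect1; exact: (line_adj_common gh xg xh).
Qed.

Lemma line_graph_connected : connected_graph G -> connected_graph (line_graph G).
Proof.
move=> Gc g h.
have [x [x1 [_ gE]]] := line_vertexP g; have [y [y1 [_ hE]]] := line_vertexP h.
have xg : x \in val g by rewrite gE !inE eqxx.
have yh : y \in val h by rewrite hE !inE eqxx.
have /connectP[q pq yE] := Gc x y.
elim: q x g {x1 gE} xg pq yE => [|x1 q IH] x g xg /=.
  by move=> _ yx; apply: (@connect_common _ _ x) => //; rewrite -yx.
case/andP=> xx1 pq yE.
have [m mE] := edge_vertex xx1.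
apply: (@connect_trans _ _ m).
  by apply: (@connect_common _ _ x) => //; rewrite mE !inE eqxx.
by apply: (IH x1 m) => //; rewrite mE !inE eqxx orbT.
Qed.

End LineGraphEdges.

Section LineGraphNetwork.
Variables (R : realType) (G : sgraph).
Implicit Types (x y u v w z : G) (g h : line_vertex G).

Definition on_darts (phi : line_vertex G -> R) x y : R :=
  oapp phi 0 (insub [set x; y]%SET).

Lemma on_dartsE phi g x y : val g = [set x; y]%SET -> on_darts phi x y = phi g.
Proof. by move=> gE; rewrite /on_darts -gE valK. Qed.

Lemma on_dartsC phi x y : on_darts phi x y = on_darts phi y x.
Proof. by rewrite /on_darts setUC. Qed.

Lemma sum_incident_edges (F : line_vertex G -> R) x :
  \sum_(g : line_vertex G | x \in val g) F g = \sum_(y | adj x y) on_darts F x y.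
Proof.
rewrite (eq_bigr (fun g => oapp F 0 (insub (val g)))); last by move=> g _; rewrite valK.
rewrite -(big_sub_cond (mem (edges G)) (fun S => x \in S) (fun S => oapp F 0 (insub S))).
rewrite -(@big_imset _ _ _ _ _ (fun y => [set x; y]%SET) (mem (@adj G x))
  (fun S => oapp F 0 (insub S))) /=; last first.
  move=> y z; rewrite !unfold_in => xy _ /set2_eq[[] //|[_ yx]].
  by rewrite yx adj_irrefl in xy.
apply: eq_bigl => S; apply/andP/imsetP => [[SE xS]|[y xy ->]]; last first.
  by rewrite mem_edges !inE eqxx.
have /imsetP[[a b]] := SE; rewrite inE /= => ab SE'.
move: xS; rewrite SE' !inE => /orP[]/eqP ->.
  by exists b.
by exists a; [rewrite unfold_in /= adj_sym | rewrite setUC].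
Qed.

(** The neighbours of the edge xy in the line graph are its neighbours in the
    cliques of x and of y; the edge itself contributes zero to both sums. *)
Lemma laplacian_line_graph (phi : line_graph G -> R) (g : line_graph G) x y :
  adj x y -> val g = [set x; y]%SET ->
  laplacian phi g = \sum_(z | adj x z) (on_darts phi x y - on_darts phi x z)
    + \sum_(z | adj y z) (on_darts phi x y - on_darts phi y z).
Proof.
move=> xy gE; pose K (h : line_vertex G) := phi g - phi h.
have KE a b : adj a b -> on_darts K a b = on_darts phi x y - on_darts phi a b.
  move=> /edge_vertex[h hE]; by rewrite !(on_dartsE _ hE) (on_dartsE _ gE).
rewrite -(eq_bigr _ (fun z xz => KE x z xz)) -(eq_bigr _ (fun z yz => KE y z yz)).
rewrite -!sum_incident_edges /laplacian.
rewrite [LHS]big_mkcond [X in _ = X + _]big_mkcond [X in _ = _ + X]big_mkcond.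
rewrite -big_split /=; apply: eq_bigr => h _.
have [<-|gh] := eqVneq g h.
  by rewrite /line_adj eqxx /K subrr; do 2!case: ifP; rewrite ?addr0.
have common : line_adj g h = (x \in val h) || (y \in val h).
  rewrite /line_adj gh gE /=; apply/pred0Pn/orP => [[z /andP[/= + zh]]|].
    by rewrite !inE => /orP[]/eqP <-; [left | right].
  by move=> [xh|yh]; [exists x | exists y]; rewrite /= !inE eqxx ?orbT.
rewrite common; case xh: (x \in val h) => /=; last by rewrite add0r.
rewrite ifF ?addr0 //; apply: contraNF gh => yh.
apply/eqP/val_inj; rewrite gE; have [a [b [_ hE]]] := line_vertexP h.
move: xh yh (adj_neq xy); rewrite hE => /set2P[]-> /set2P[]-> //; rewrite ?eqxx //.
by rewrite setUC.
Qed.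

Definition edge_ind u v x y : R :=
  ((x == u) && (y == v))%:R + ((x == v) && (y == u))%:R.

(** i x y is the current that leaves x towards the midpoint of xy, when one unit
    enters at the midpoint of uv and leaves at the midpoint of wz. *)
Definition midpoint_flow u v w z (i : G -> G -> R) :=
  (forall x, \sum_(y | adj x y) i x y = 0) /\
  forall x y, adj x y -> i x y + i y x = edge_ind w z x y - edge_ind u v x y.

Lemma dart_sum_edge_ind u v (F : G -> G -> R) : adj u v ->
  dart_sum (fun x y => F x y * edge_ind u v x y) = F u v + F v u.
Proof.
move=> uv; rewrite (eq_dart_sum (F2 := fun x y => F x y * ((x == u) && (y == v))%:R
   + F x y * ((x == v) && (y == u))%:R)); last by move=> x y _; rewrite /edge_ind mulrDr.
by rewrite dart_sumD !dart_sum_delta // adj_sym.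
Qed.

(** The clique that a vertex of degree d contributes to the line graph is
    equivalent to a star with legs of resistance 1/d, so the line graph is the
    subdivision of G with these resistances, and every flow between the two
    midpoints bounds the effective resistance by its energy. *)
Lemma line_res_le u v w z (e f : line_graph G) (i : G -> G -> R) :
  connected_graph G -> adj u v -> adj w z ->
  val e = [set u; v]%SET -> val f = [set w; z]%SET -> midpoint_flow u v w z i ->
  eff_res R e f <= \sum_x sqr_at i x / (deg x)%:R.
Proof.
move=> Gc uv wz eE fE [i0 i1].
have Lc := line_graph_connected Gc.
have [phi hphi] := @potential_exists R (line_graph G) e f Lc.
rewrite (eff_res_potential Lc hphi).
pose F := on_darts phi.
have FC x y : F x y = F y x by exact: on_dartsC.
rewrite -(on_dartsE phi eE) -(on_dartsE phi fE) -/F; set r := _ - _.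
pose mean x := (\sum_(y | adj x y) F x y) / (deg x)%:R.
pose psi x y := F x y - mean x.
have d_gt0 x y : adj x y -> 0 < (deg x)%:R :> R.
  by move=> xy; rewrite ltr0n; apply/card_gt0P; exists y.
have sum_diff x y : adj x y ->
    \sum_(t | adj x t) (F x y - F x t) = (deg x)%:R * psi x y.
  move=> xy; rewrite sumrB sumr_const -[F x y *+ _]mulr_natl /psi /mean mulrBr; congr (_ - _).
  by rewrite mulrC divfK // gt_eqF // (d_gt0 _ _ xy).
have psi0 x : \sum_(y | adj x y) psi x y = 0.
  have [y xy|none] := pickP (@adj G x); last by rewrite big_pred0.
  rewrite sumrB sumr_const -[mean x *+ _]mulr_natl /mean mulrC divfK ?subrr //.
  by rewrite gt_eqF // (d_gt0 _ _ xy).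
have kirchhoff x y : adj x y ->
    (deg x)%:R * psi x y + (deg y)%:R * psi y x = edge_ind u v x y - edge_ind w z x y.
  move=> xy; have yx : adj y x by rewrite adj_sym.
  have [g gE] := edge_vertex xy.
  have ind a b (h : line_graph G) : adj a b -> val h = [set a; b]%SET ->
      edge_ind a b x y = (g == h)%:R.
    move=> ab hE; rewrite /edge_ind; case: (eqVneq g h) => [gh|gh].
      have : [set x; y]%SET = [set a; b]%SET by rewrite -gE -hE gh.
      move=> /set2_eq[[-> ->]|[-> ->]]; rewrite !eqxx /=.
        by rewrite (negPf (adj_neq ab)) addr0.
      by rewrite eq_sym (negPf (adj_neq ab)) add0r.
    case: eqP => [xa|_] /=; last case: eqP => [xb|_] /=; rewrite ?addr0 ?add0r //.
    - case: eqP => [yb|_] /=.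
        by case/eqP: gh; apply: val_inj; rewrite gE hE xa yb.
      by rewrite add0r xa (negPf (adj_neq ab)).
    - case: eqP => [ya|_] //=.
      by case/eqP: gh; apply: val_inj; rewrite gE hE xb ya setUC.
  rewrite -!sum_diff // (FC y x) (ind _ _ _ uv eE) (ind _ _ _ wz fE) -(hphi g).
  by rewrite -(laplacian_line_graph phi xy gE).
pose V x := \sum_(y | adj x y) psi x y ^+ 2.
(* The energy of the potential is the resistance r. *)
have dV : \sum_x (deg x)%:R * V x = r.
  have -> : \sum_x (deg x)%:R * V x
      = dart_sum (fun x y => F x y * ((deg x)%:R * psi x y)).
    apply: eq_bigr => x _.
    have -> : V x = \sum_(y | adj x y) F x y * psi x y.
      rewrite [RHS](eq_bigr (fun y => psi x y ^+ 2 + mean x * psi x y)).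
        by rewrite big_split /= -mulr_sumr psi0 mulr0 addr0.
      by move=> y _; rewrite /psi; ring.
    by rewrite mulr_sumr; apply: eq_bigr => y _; ring.
  set S := dart_sum _.
  have : S + S = 2 * r; last by lra.
  rewrite {2}/S dart_sum_rev -dart_sumD.
  rewrite (eq_dart_sum (F2 := fun x y => F x y * edge_ind u v x y
     + (-1) * (F x y * edge_ind w z x y))); last first.
    by move=> x y xy; rewrite (FC y x) -mulrDr kirchhoff //; ring.
  by rewrite dart_sumD dart_sumZ !dart_sum_edge_ind // (FC v u) (FC z w) /r; ring.
(* The flow i works against the same potential difference. *)
have work : dart_sum (fun x y => i x y * F x y) = - r.
  set S := dart_sum _.
  have : S + S = - 2 * r; last by lra.
  rewrite {2}/S dart_sum_rev -dart_sumD.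
  rewrite (eq_dart_sum (F2 := fun x y => F x y * edge_ind w z x y
     + (-1) * (F x y * edge_ind u v x y))); last first.
    by move=> x y xy; rewrite (FC y x) -mulrDl i1 //; ring.
  by rewrite dart_sumD dart_sumZ !dart_sum_edge_ind // (FC v u) (FC z w) /r; ring.
have : r <= \sum_x (sqr_at i x / (deg x)%:R + (deg x)%:R * V x) / 2; last first.
  by rewrite -mulr_suml big_split /= dV; lra.
rewrite -[r]opprK -work -sumrN; apply: ler_sum => x _.
have -> : \sum_(y | adj x y) i x y * F x y = \sum_(y | adj x y) i x y * psi x y.
  rewrite [LHS](eq_bigr (fun y => i x y * psi x y + mean x * i x y)).
    by rewrite big_split /= -mulr_sumr i0 mulr0 addr0.
  by move=> y _; rewrite /psi; ring.
rewrite /sqr_at /V mulr_suml mulr_sumr -big_split /= mulr_suml -sumrN.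
apply: ler_sum => y xy; have d0 := d_gt0 _ _ xy.
have : 0 <= (i x y / (deg x)%:R + psi x y) ^+ 2 * (deg x)%:R.
  by rewrite mulr_ge0 ?sqr_ge0 // ltW.
rewrite (_ : _ * _ = i x y ^+ 2 / (deg x)%:R + (deg x)%:R * psi x y ^+ 2 + 2 * (i x y * psi x y)).
  lra.
by field; rewrite gt_eqF.
Qed.

End LineGraphNetwork.

(** * Resistances between the ends of two edges *)

Section TwoEdges.
Variables (R : realType) (G : sgraph).
Implicit Types (x y t : G) (a b m : G -> R).

Lemma laplacian_lin m a b (c d : R) x :
  laplacian (fun t => m t + c * a t + d * b t) x
  = laplacian m x + c * laplacian a x + d * laplacian b x.
Proof.
rewrite /laplacian !mulr_sumr -!big_split /=.
by apply: eq_bigr => y _; ring.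
Qed.

(** m drives one unit from uv to wz, entering and leaving half at each end. *)
Definition averaged_potential u v w z m := forall x : G,
  laplacian m x = ((x == u)%:R + (x == v)%:R - (x == w)%:R - (x == z)%:R) / 2.

(** The current in the subdivision of G, driven by m and by the source and the sink
    at the midpoints, each of which sends half of its unit to either side. *)
Definition half_flow u v w z m x y : R :=
  m x - m y - edge_ind R u v x y / 2 + edge_ind R w z x y / 2.

Lemma edge_indC u v x y : edge_ind R (G := G) u v x y = edge_ind R u v y x.
Proof. by rewrite /edge_ind addrC ![(x == _) && _]andbC. Qed.

Lemma edge_ind_swap u v x y : edge_ind R (G := G) u v x y = edge_ind R v u x y.
Proof. by rewrite /edge_ind addrC. Qed.

Lemma half_flow_swap u v w z m :
  half_flow u v w z m = half_flow v u w z m /\ half_flow u v w z m = half_flow u v z w m.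
Proof.
by split; apply/funext => x; apply/funext => y; rewrite /half_flow;
  rewrite ?(edge_ind_swap u) ?(edge_ind_swap w).
Qed.

Lemma sum_edge_ind u v x : adj u v ->
  \sum_(y | adj x y) edge_ind R u v x y = (x == u)%:R + (x == v)%:R.
Proof.
move=> uv; rewrite big_split /=.
by rewrite !sum_adj_delta // adj_sym.
Qed.

Lemma averaged_green u v w z m p : averaged_potential u v w z m ->
  \sum_x p x * laplacian m x = (p u + p v - p w - p z) / 2.
Proof.
move=> hm; rewrite (eq_bigr (fun x => 2^-1 * (p x * (x == u)%:R + p x * (x == v)%:R
   + ((-1) * (p x * (x == w)%:R) + (-1) * (p x * (x == z)%:R))))).
  by rewrite -mulr_sumr !big_split /= -!mulr_sumr !sum_delta; field.
by move=> x _; rewrite hm; field.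
Qed.

(** What the subdivision loses when its half-edges, of resistance 1/2 in G, get
    the resistances 1/deg of the line graph. *)
Definition gain (i : G -> G -> R) := \sum_x (2^-1 - (deg x)%:R^-1) * sqr_at i x.

Section Fixed.
Variables (u v w z : G) (m a b : G -> R).
Hypotheses (Gc : connected_graph G) (uv : adj u v) (wz : adj w z).
Hypothesis ef : [set u; v]%SET != [set w; z]%SET.
Hypothesis hm : averaged_potential u v w z m.
Hypothesis ha : unit_current_potential u v a.
Hypothesis hb : unit_current_potential w z b.

Let i := half_flow u v w z m.

Lemma half_flow_midpoint : midpoint_flow u v w z i.
Proof.
split=> [x|x y xy].
  rewrite (eq_bigr (fun y => (m x - m y)
     + (- 2^-1 * edge_ind R u v x y + 2^-1 * edge_ind R w z x y))).
    rewrite big_split /= [X in _ + X]big_split /= -/(laplacian m x) hm -!mulr_sumr.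
    rewrite !sum_edge_ind //.
    by field.
  by move=> y _; rewrite /i /half_flow; field.
by rewrite /i /half_flow (edge_indC u v y) (edge_indC w z y); field.
Qed.

Lemma edge_ind_uv : [/\ edge_ind R u v u v = 1, edge_ind R u v v u = 1,
  edge_ind R w z u v = 0 & edge_ind R w z v u = 0].
Proof.
have nuv := negPf (adj_neq uv).
have e1 : (u == w) && (v == z) = false.
  by apply: contraNF ef => /andP[/eqP -> /eqP ->].
have e2 : (u == z) && (v == w) = false.
  by apply: contraNF ef => /andP[/eqP -> /eqP ->]; rewrite setUC.
have e3 : (v == w) && (u == z) = false by rewrite andbC.
have e4 : (v == z) && (u == w) = false by rewrite andbC.
by rewrite /edge_ind !eqxx nuv eq_sym nuv e1 e2 e3 e4 !addr0 add0r.
Qed.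

Lemma edge_ind_disjoint x y : edge_ind R u v x y * edge_ind R w z x y = 0.
Proof.
have [_ _ e1 e2] := edge_ind_uv.
rewrite {1}/edge_ind mulrDl.
case: andP => [[/eqP -> /eqP ->]|_]; first by rewrite e1 !mulr0 addr0.
case: andP => [[/eqP -> /eqP ->]|_]; first by rewrite e2 !mulr0 addr0.
by rewrite !mul0r addr0.
Qed.

Lemma half_flow_sqr : \sum_x sqr_at i x = m u + m v - m w - m z + 1.
Proof.
have vu : adj v u by rewrite adj_sym.
have zw : adj z w by rewrite adj_sym.
have [p1 p2 q1 q2] := edge_ind_uv.
have [r1 r2] : edge_ind R w z w z = 1 /\ edge_ind R w z z w = 1.
  by rewrite /edge_ind !eqxx (negPf (adj_neq wz)) eq_sym (negPf (adj_neq wz)) addr0 add0r.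
pose d x y := m x - m y.
pose p := edge_ind R u v; pose q := edge_ind R w z.
have -> : \sum_x sqr_at i x = dart_sum (fun x y => d x y * d x y
    + ((-1) * (d x y * p x y) + (d x y * q x y
    + (4^-1 * (p x y * p x y) + 4^-1 * (q x y * q x y))))).
  apply: eq_bigr => x _; apply: eq_bigr => y _.
  rewrite -[RHS]subr0 -[X in _ - X](mulr0 2^-1) -(edge_ind_disjoint x y).
  by rewrite /i /half_flow -/p -/q /d; field.
rewrite !dart_sumD !dart_sumZ !dart_sum_edge_ind // /p /q p1 p2 r1 r2.
rewrite dart_sum_grad; last by move=> x y _; rewrite /d opprB.
under eq_bigr do rewrite -/(laplacian m _).
by rewrite (averaged_green _ hm) /d; field.
Qed.

(** The potentials for the four pairs of ends differ from m by half the potentials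
    of the two edges. *)
Lemma potential_uw : unit_current_potential u w (fun t => m t + 2^-1 * a t + - 2^-1 * b t).
Proof.
by move=> x; have := laplacian_lin m a b 2^-1 (- 2^-1) x; rewrite {1}/laplacian => ->;
  rewrite hm {1}/laplacian ha {1}/laplacian hb; field.
Qed.

Lemma potential_uz : unit_current_potential u z (fun t => m t + 2^-1 * a t + 2^-1 * b t).
Proof.
by move=> x; have := laplacian_lin m a b 2^-1 2^-1 x; rewrite {1}/laplacian => ->;
  rewrite hm {1}/laplacian ha {1}/laplacian hb; field.
Qed.

Lemma potential_vz : unit_current_potential v z (fun t => m t + - 2^-1 * a t + 2^-1 * b t).
Proof.
by move=> x; have := laplacian_lin m a b (- 2^-1) 2^-1 x; rewrite {1}/laplacian => ->;
  rewrite hm {1}/laplacian ha {1}/laplacian hb; field.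
Qed.

Lemma potential_vw : unit_current_potential v w (fun t => m t + - 2^-1 * a t + - 2^-1 * b t).
Proof.
by move=> x; have := laplacian_lin m a b (- 2^-1) (- 2^-1) x; rewrite {1}/laplacian => ->;
  rewrite hm {1}/laplacian ha {1}/laplacian hb; field.
Qed.

Lemma reciprocity : a w - a z = b u - b v.
Proof. by rewrite -(green_unit _ ha) -(green_unit _ hb) green. Qed.

Lemma drop_uv : m u - m v = (a u + a v - a w - a z) / 2.
Proof. by rewrite -(green_unit _ ha) (averaged_green _ hm). Qed.

Lemma drop_wz : m w - m z = (b u + b v - b w - b z) / 2.
Proof. by rewrite -(green_unit _ hb) (averaged_green _ hm). Qed.

Lemma edge_cycle_self s t c : adj s t -> edge_cycle (R := R) s t c s t = 1 - (c s - c t).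
Proof. by move=> /adj_neq /negPf st; rewrite /edge_cycle !eqxx st /= subr0. Qed.

Lemma edge_cycle_uv_wz : edge_cycle u v a w z = - (a w - a z).
Proof.
have [_ _ q1 q2] := edge_ind_uv; rewrite /edge_cycle.
case: andP => [[/eqP wu /eqP zv]|_]; first by case/eqP: ef; rewrite wu zv.
case: andP => [[/eqP wv /eqP zu]|_]; first by case/eqP: ef; rewrite wv zu setUC.
by rewrite subrr add0r.
Qed.

Lemma edge_cycle_wz_uv : edge_cycle w z b u v = - (b u - b v).
Proof.
rewrite /edge_cycle.
case: andP => [[/eqP wu /eqP zv]|_]; first by case/eqP: ef; rewrite wu zv.
case: andP => [[/eqP wv /eqP zu]|_]; first by case/eqP: ef; rewrite wv zu setUC.
by rewrite subrr add0r.
Qed.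

Section Comparison.
Variables e f : line_graph G.
Hypotheses (eE : val e = [set u; v]%SET) (fE : val f = [set w; z]%SET).

Lemma line_res_gain :
  eff_res R e f + gain i <= (m u + m v - m w - m z + 1) / 2.
Proof.
rewrite -half_flow_sqr -lerBrDr.
apply: le_trans (line_res_le Gc uv wz eE fE half_flow_midpoint) _.
rewrite /gain mulr_suml -sumrB; apply: ler_sum => x _.
by rewrite le_eqVlt; apply/orP; left; apply/eqP; ring.
Qed.

(** The average of the resistances of (u, w) and (v, z) falls short of the
    resistance between the midpoints by a quarter of the energy of the difference
    of the two edge cycles. *)
Lemma compare_pairing : eff_res R e f + gain i <= res_diam R G
  + energy (fun x y => edge_cycle u v a x y - edge_cycle w z b x y) / 4.
Proof.
apply: le_trans line_res_gain _.
rewrite (energyB uv wz ha hb) !edge_cycle_self // edge_cycle_uv_wz edge_cycle_wz_uv.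
have := @eff_res_le_diam R G u w; have := @eff_res_le_diam R G v z.
rewrite (eff_res_potential Gc potential_uw) (eff_res_potential Gc potential_vz).
by have := reciprocity; lra.
Qed.

(** The resistances of u and of v to the ends of wz have averages that differ by
    twice m u - m v; the larger one is used. *)
Lemma compare_drop_uv : eff_res R e f + gain i + `|m u - m v| <= res_diam R G
  + (edge_cycle u v a u v + edge_cycle w z b w z) / 4.
Proof.
have := line_res_gain; rewrite !edge_cycle_self //.
have := @eff_res_le_diam R G u w; have := @eff_res_le_diam R G v z.
have := @eff_res_le_diam R G u z; have := @eff_res_le_diam R G v w.
rewrite (eff_res_potential Gc potential_uw) (eff_res_potential Gc potential_vz).
rewrite (eff_res_potential Gc potential_uz) (eff_res_potential Gc potential_vw).
have := drop_uv; case: (ler0P (m u - m v)) => _; lra.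
Qed.

Lemma compare_drop_wz : eff_res R e f + gain i + `|m w - m z| <= res_diam R G
  + (edge_cycle u v a u v + edge_cycle w z b w z) / 4.
Proof.
have := line_res_gain; rewrite !edge_cycle_self //.
have := @eff_res_le_diam R G u w; have := @eff_res_le_diam R G v z.
have := @eff_res_le_diam R G u z; have := @eff_res_le_diam R G v w.
rewrite (eff_res_potential Gc potential_uw) (eff_res_potential Gc potential_vz).
rewrite (eff_res_potential Gc potential_uz) (eff_res_potential Gc potential_vw).
have := drop_wz; case: (ler0P (m w - m z)) => _; lra.
Qed.

End Comparison.

End Fixed.
End TwoEdges.

(** * Local estimates *)

Section Local.
Variables (R : realType) (G : sgraph).
Implicit Types (x y z t : G) (om i : G -> G -> R) (s : seq G).

Definition rest om x s := \sum_(y | adj x y && (y \notin s)) om x y ^+ 2.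

Lemma rest_ge0 om x s : 0 <= rest om x s. Proof. exact: sum_sqr_ge0. Qed.

Lemma rest0 om x : sqr_at om x = rest om x [::].
Proof. by apply: eq_bigl => y; rewrite andbT. Qed.

Lemma rest_cons om x y s : adj x y -> y \notin s ->
  rest om x s = om x y ^+ 2 + rest om x (y :: s).
Proof.
move=> xy ys; rewrite /rest (bigD1 y) /=; last by rewrite xy.
congr (_ + _); apply: eq_bigl => z; rewrite inE negb_or -andbA.
by congr (_ && _); rewrite andbC.
Qed.

Lemma rest_del om x y s : y != x -> rest (del_at x om) y s = rest om y (x :: s).
Proof.
move=> yx; rewrite /rest big_mkcond [RHS]big_mkcond /=; apply: eq_bigr => z _.
rewrite /del_at (negPf yx) inE negb_or /=.
by case: (adj y z); case: (z == x); case: (z \in s); rewrite ?expr0n.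
Qed.

Lemma rest_ge om x y s : adj x y -> y \notin s -> om x y ^+ 2 <= rest om x s.
Proof. by move=> xy ys; rewrite (rest_cons om xy ys) lerDl rest_ge0. Qed.

(** What enters a vertex along the edges to s leaves along the remaining ones. *)
Lemma rest_ge_card om x s : \sum_(y | adj x y) om x y = 0 ->
  uniq s -> all (@adj G x) s ->
  (\sum_(y <- s) om x y) ^+ 2 <= ((deg x)%:R - (size s)%:R) * rest om x s.
Proof.
move=> om0 us /allP sx.
have inS y : (adj x y) && (y \in s) = (y \in s).
  by case ys: (y \in s); rewrite ?andbF // andbT (sx y ys).
have sumS (F : G -> R) : \sum_(y | adj x y && (y \in s)) F y = \sum_(y <- s) F y.
  by rewrite (eq_bigl _ _ inS) big_uniq.
have -> : \sum_(y <- s) om x y = - \sum_(y | adj x y && (y \notin s)) om x y.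
  by apply/eqP; rewrite -addr_eq0 -sumS -(bigID (mem s)) om0.
have -> : (deg x)%:R - (size s)%:R = #|[pred y | adj x y && (y \notin s)]|%:R :> R.
  apply/eqP; rewrite subr_eq -natrD eqr_nat addnC /deg -sum1_card (bigID (mem s)) /=.
  rewrite -[in X in _ == X]sum1_card.
  by rewrite (eq_bigl _ _ inS) -(card_uniqP us) -sum1_card.
by rewrite sqrrN; exact: sqr_sum_le_card.
Qed.

Definition conserved om := forall x, \sum_(y | adj x y) om x y = 0.

Lemma deg_gt0 x y : adj x y -> (0 < deg x)%N.
Proof. by move=> xy; apply/card_gt0P; exists y. Qed.

Lemma deg1_zero om x y : conserved om -> deg x = 1%N -> adj x y -> om x y = 0.
Proof.
move=> om0 d1 xy; have := rest_ge_card (s := [:: y]) (om0 x) isT.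
rewrite /= xy big_seq1 d1 subrr mul0r => /(_ isT) h.
by apply/eqP; rewrite -sqrf_eq0 eq_le h sqr_ge0.
Qed.

Definition vertex_gain i x := (2^-1 - (deg x)%:R^-1) * sqr_at i x.

Lemma vertex_gain_ge0 i x : conserved i -> 0 <= vertex_gain i x.
Proof.
move=> i0; rewrite /vertex_gain; have [[|[|d]] dE] : exists n, deg x = n by exists (deg x).
- rewrite /sqr_at big_pred0 ?mulr0 // => y; apply/negP => /deg_gt0.
  by rewrite dE.
- rewrite /sqr_at big1 ?mulr0 // => y xy.
  by rewrite (deg1_zero i0 dE xy) expr0n.
rewrite mulr_ge0 ?sqr_at_ge0 // dE subr_ge0 lef_pV2 ?posrE ?ltr0n //.
by rewrite ler_nat.
Qed.

Lemma gain_ge i s : conserved i -> uniq s -> \sum_(x <- s) vertex_gain i x <= gain i.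
Proof.
move=> i0 us; rewrite big_uniq //= /gain [leRHS](bigID (mem s)) /= lerDl.
by apply: sumr_ge0 => x _; exact: vertex_gain_ge0.
Qed.

Lemma gain_ge0 i : conserved i -> 0 <= gain i.
Proof. by move=> i0; apply: sumr_ge0 => x _; exact: vertex_gain_ge0. Qed.

Lemma vertex_gainE i x : (2 < deg x)%N ->
  vertex_gain i x = sqr_at i x / (2 + 4 / ((deg x)%:R - 2)).
Proof.
move=> d3; have : 3 <= (deg x)%:R :> R by rewrite ler_nat.
rewrite /vertex_gain; set d : R := _%:R => d3R.
by field; apply/and3P; split; apply/eqP; lra.
Qed.

(** The current on the edge xy spreads over the deg x - 1 other edges. The sharp
    constant 2 + 2 / (deg x - 2) is weakened to the form in which the same
    spreading enters the energy of a circulation. *)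
Lemma vertex_gain_ge1 i x y : conserved i -> (2 < deg x)%N -> adj x y ->
  i x y ^+ 2 / (2 + 4 / ((deg x)%:R - 1)) <= vertex_gain i x.
Proof.
move=> i0 d3 xy; have d3R : 3 <= (deg x)%:R :> R by rewrite ler_nat.
have := rest_ge_card (s := [:: y]) (i0 x) isT; rewrite /= xy big_seq1 => /(_ isT).
rewrite /vertex_gain rest0 (@rest_cons i x y [::] xy isT); move: d3R.
set d : R := (deg x)%:R; set r := rest _ _ _; set q := _ ^+ 2 => d3R h.
have q0 : 0 <= q by exact: sqr_ge0.
rewrite -subr_ge0.
have -> : (2^-1 - d^-1) * (q + r) - q / (2 + 4 / (d - 1))
    = ((d - 2) * (d + 1) * ((d - 1) * (q + r)) - q * (d - 1) * (d - 1) * d)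
      / (2 * d * (d + 1) * (d - 1)).
  by field; do ?(apply/andP; split); apply/eqP; lra.
apply: divr_ge0; last by do ?apply: mulr_ge0; lra.
have k0 : 0 <= (d - 2) * (d + 1) by apply: mulr_ge0; lra.
have rq : q * d <= (d - 1) * (q + r) by lra.
have k1 : 0 <= q * d * (d - 3) by do ?apply: mulr_ge0 => //; lra.
by have := ler_wpM2l k0 rq; lra.
Qed.

End Local.

(** * Chains of vertices of degree 2 *)

Section Chains.
Variables (R : realType) (G : sgraph).
Implicit Types (x y z t h : G) (om i : G -> G -> R) (d : G * G).

Lemma deg2P x y : deg x = 2 -> adj x y ->
  exists z, [/\ adj x z, z != y & forall t, adj x t -> t = y \/ t = z].
Proof.
move=> d2 xy; have yx : y \in @adj G x by exact: xy.
have : #|[predD1 @adj G x & y]| == 1%N.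
  by have := cardD1 y (@adj G x); rewrite yx -/(deg x) d2 add1n => -[<-].
move=> /eqP/mem_card1[z zP].
have := zP z; rewrite !inE eqxx => /andP[zy xz].
exists z; split=> // t xt; have [->|ty] := eqVneq t y; first by left.
have tx : t \in @adj G x by exact: xt.
by right; apply/eqP; have := zP t; rewrite !inE ty /= => <-.
Qed.

Lemma deg2_sum i x y z : conserved i -> deg x = 2 -> adj x y -> adj x z -> z != y ->
  i x z = - i x y.
Proof.
move=> i0 d2 xy xz zy; apply/eqP; rewrite -addr_eq0; apply/eqP.
have := rest_ge_card (s := [:: y; z]) (i0 x).
rewrite /= inE eq_sym zy xy xz => /(_ isT isT).
rewrite d2 subrr mul0r big_cons big_seq1 addrC => h.
by apply/eqP; rewrite -sqrf_eq0 eq_le h sqr_ge0.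
Qed.

Definition chain_step d d' :=
  [&& d'.1 == d.2, adj d'.1 d'.2, deg d.2 == 2 & d'.2 != d.1].

Definition circulations_agree d d' := forall om, circulation om -> om d.1 d.2 = om d'.1 d'.2.

(** Conservation at a vertex of degree 2 hands the current on unchanged. *)
Lemma chain_circulation d0 d : adj d0.1 d0.2 -> connect chain_step d0 d ->
  adj d.1 d.2 /\ circulations_agree d0 d.
Proof.
move=> a0 /connectP[p pp ->{d}].
elim/last_ind: p pp => [//|p d IH]; rewrite rcons_path last_rcons => /andP[pp].
have [] := IH pp; move: (last _ _) => [x x'] /= xy ag; case: d => y z.
case/and4P => /= /eqP -> yz /eqP d2 zx; split=> // om co; rewrite (ag om co) /=.
have yx : adj x' x by rewrite adj_sym.
by rewrite (deg2_sum co.2 d2 yx yz zx) co.1.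
Qed.

Definition chain_next d := (d.2, odflt d.1 [pick z | adj d.2 z && (z != d.1)]).

Lemma chain_nextP d : adj d.1 d.2 -> deg d.2 = 2 -> chain_step d (chain_next d).
Proof.
case: d => x y /= xy d2; rewrite /chain_step /chain_next /= eqxx /= d2 eqxx.
case: pickP => [z /andP[yz zx]|none] /=; first by rewrite yz zx.
have [|z [yz zx _]] := @deg2P y x d2; first by rewrite adj_sym.
by have := none z; rewrite yz zx.
Qed.

(** If the walk from uv never meets a branching vertex or a leaf, it is a
    permutation of the darts that it meets; their heads are then closed under
    adjacency, and they are all the vertices. *)
Lemma chain_exhausts u v : connected_graph G -> adj u v ->
  (forall d, connect chain_step (u, v) d -> deg d.2 = 2) ->
  forall w z, adj w z ->
    connect chain_step (u, v) (w, z) \/ connect chain_step (u, v) (z, w).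
Proof.
move=> Gc uv all2 w z wz.
pose A := [set d | connect chain_step (u, v) d]%SET.
have Aadj d : d \in A -> adj d.1 d.2.
  by rewrite inE => /(@chain_circulation (u, v) d uv)[].
have Adeg d : d \in A -> deg d.2 = 2 by rewrite inE; exact: all2.
have Astep d d' : d \in A -> chain_step d d' -> d' \in A.
  by rewrite !inE => c s; exact: connect_trans c (connect1 s).
have Anext d : d \in A -> chain_next d \in A.
  by move=> dA; apply: (Astep _ _ dA); apply: chain_nextP; [exact: Aadj | exact: Adeg].
have inj : {in A &, injective chain_next}.
  move=> [x y] [x' y'] dA dA' E.
  have := chain_nextP (Aadj _ dA) (Adeg _ dA); rewrite E.
  have := chain_nextP (Aadj _ dA') (Adeg _ dA').
  case/and4P; rewrite /= => _ _ _ n1 /and4P[/= /eqP e1 a1 _ n2].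
  rewrite e1 in a1 *; move: (Aadj _ dA) (Aadj _ dA'); rewrite /= -e1 => a2 a3.
  have := Adeg _ dA; rewrite /= -e1 => d2.
  have [|t [_ _ tP]] := @deg2P y' x' d2; first by rewrite adj_sym.
  have y'x : adj y' x by rewrite adj_sym.
  have [->//|xt] := tP _ y'x; rewrite -e1 in a1.
  by have [h|h] := tP _ a1; [rewrite h eqxx in n1 | rewrite h -xt eqxx in n2].
have surj : chain_next @: A = A.
  apply/eqP; rewrite eqEcard card_in_imset // leqnn andbT.
  by apply/subsetP => _ /imsetP[d dA ->]; exact: Anext.
have cl : closed (@adj G) [pred y | [exists d in A, d.2 == y]].
  apply: intro_closed; first by apply: sym_connect_sym; exact: adj_sym.
  move=> y t yt; rewrite !inE => /exists_inP[d dA /eqP dy].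
  have /imsetP[d0 d0A dE] : d \in chain_next @: A by rewrite surj.
  have dd : adj d.2 d.1 by rewrite adj_sym (Aadj _ dA).
  have [s [_ _ sP]] := deg2P (Adeg _ dA) dd.
  have := chain_nextP (Aadj _ dA) (Adeg _ dA) => /and4P[/eqP e1 a1 _ n1].
  have st : s = (chain_next d).2.
    by rewrite e1 in a1; have [h|->//] := sP _ a1; rewrite h eqxx in n1.
  rewrite -dy in yt; have [->|->] := sP _ yt.
    by apply/exists_inP; exists d0 => //; rewrite dE.
  by apply/exists_inP; exists (chain_next d); rewrite ?Anext ?st.
have := closed_connect cl (Gc v w); rewrite !inE.
have -> : [exists d in A, d.2 == v].
  by apply/exists_inP; exists (u, v); rewrite // inE connect0.
move=> /esym/exists_inP[[x w'] dA /= /eqP ew]; rewrite ew in dA.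
have [<-|zx] := eqVneq x z; first by right; move: dA; rewrite inE.
left; have := @Astep _ (w, z) dA; rewrite inE; apply.
by rewrite /chain_step /= eqxx wz (Adeg _ dA) eqxx eq_sym zx.
Qed.

(** A dart (t, h) is the end of the chain that leaves the midpoint of uv towards
    v. Its head branches, and both circulations and the current i are the same
    as at v. The last two fields serve to tell chains of a single edge
    from longer ones. *)
Record chain_end i u v t h : Prop := ChainEnd {
  chain_end_adj : adj t h;
  chain_end_deg : (2 < deg h)%N;
  chain_end_circulation : circulations_agree (u, v) (t, h);
  chain_end_flow : i h t = i v u;
  chain_end_tail : (t, h) = (u, v) \/ deg t = 2;
  chain_end_stop : deg v <> 2 -> (t, h) = (u, v) }.

(** Edges of a common chain are parallel, up to orientation. *)
Definition parallel d d' := circulations_agree d d' \/ circulations_agree d (d'.2, d'.1).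

(** These edges are the bridges of G. *)
Definition acyclic_edge d := forall om, circulation om -> om d.1 d.2 = 0.

Lemma edge_ind_eq0 u v x y : (x, y) <> (u, v) -> (x, y) <> (v, u) ->
  edge_ind R (G := G) u v x y = 0.
Proof.
move=> n1 n2; rewrite /edge_ind.
case: andP => [[/eqP e1 /eqP e2]|_]; first by case: n1; rewrite e1 e2.
case: andP => [[/eqP e1 /eqP e2]|_]; first by case: n2; rewrite e1 e2.
by rewrite addr0.
Qed.

(** The walk from uv does not come back along vu, since circulations would vanish
    on uv; it does not meet wz, since the edges would be parallel; and it does not
    end in a leaf, where circulations vanish. *)
Lemma chain_end_exists u v w z i :
  connected_graph G -> adj u v -> adj w z -> midpoint_flow u v w z i ->
  ~ acyclic_edge (u, v) -> ~ parallel (u, v) (w, z) ->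
  exists t h, chain_end i u v t h.
Proof.
move=> Gc uv wz [i0 i1] nac npar.
have npar1 : ~ connect chain_step (u, v) (w, z).
  by move=> /(@chain_circulation (u, v) (w, z) uv)[_ ag]; apply: npar; left.
have npar2 : ~ connect chain_step (u, v) (z, w).
  by move=> /(@chain_circulation (u, v) (z, w) uv)[_ ag]; apply: npar; right.
have nback : ~ connect chain_step (u, v) (v, u).
  move=> /(@chain_circulation (u, v) (v, u) uv)[_ ag]; apply: nac => om co.
  by have := ag om co; have := co.1 u v; rewrite /=; lra.
have [d cd dn2] : exists2 d, connect chain_step (u, v) d & deg d.2 <> 2.
  apply: contrapT => no; have [] // := @chain_exhausts u v Gc uv _ w z wz.
  by move=> d cd; apply: contrapT => dn2; apply: no; exists d.
have [ad ag] := @chain_circulation (u, v) d uv cd.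
have inv : i d.2 d.1 = i v u /\ (d = (u, v) \/ deg d.1 = 2).
  have /connectP[p pp dE] := cd; rewrite {}dE {d cd dn2 ad ag}.
  elim/last_ind: p pp => [_|p d IH]; first by split; last left.
  rewrite rcons_path last_rcons => /andP[pp st]; have [IH1 _] := IH pp.
  have cl : connect chain_step (u, v) (last (u, v) p) by apply/connectP; exists p.
  have cd := connect_trans cl (connect1 st).
  have [al _] := @chain_circulation (u, v) _ uv cl.
  move: (last _ _) IH1 cl al st => [x y] /= IH1 cl al; case: d cd => y' t cd.
  case/and4P => /= /eqP ey yt /eqP d2 tx; subst y'.
  split; last by right.
  have [[-> ->]|nuv] := pselect ((y, t) = (u, v)); first by [].
  have nvu : (y, t) <> (v, u) by move=> e; rewrite e in cd.
  have nwz : (y, t) <> (w, z) by move=> e; rewrite e in cd.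
  have nzw : (y, t) <> (z, w) by move=> e; rewrite e in cd.
  have := i1 y t yt; rewrite !edge_ind_eq0 // subr0.
  have yx : adj y x by rewrite adj_sym.
  by rewrite (deg2_sum i0 d2 yx yt tx) IH1; lra.
exists d.1, d.2; case: d cd dn2 ad ag inv => t h /= cd hn2 th ag [iE tl].
split=> //.
  have ht : adj h t by rewrite adj_sym.
  have := deg_gt0 ht.
  case dh : (deg h) => [|[|[|n]]] // _; case: nac => om co.
  by rewrite (ag om co) /= co.1 (deg1_zero co.2 dh) ?oppr0.
move=> vn2; have /connectP[[|d' p] /= pp] := cd; first by move=> ->.
by case/andP: pp => /and4P[_ _ /eqP].
Qed.

End Chains.

(** * Circulations against the gain at branching vertices *)

Section Elementary.
Variable R : realType.
Implicit Types s t x y p q g : R.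

Lemma titu s t p q : 0 < p -> 0 < q -> (s + t) ^+ 2 = 1 ->
  (p + q)^-1 <= s ^+ 2 / p + t ^+ 2 / q.
Proof.
move=> p0 q0 st; rewrite -subr_ge0.
have -> : s ^+ 2 / p + t ^+ 2 / q - (p + q)^-1 = (q * s - p * t) ^+ 2 / (p * q * (p + q)).
  rewrite -[(p + q)^-1]mul1r -st; field.
  by do ?(apply/andP; split); apply/eqP; lra.
by rewrite divr_ge0 ?sqr_ge0 // !mulr_ge0 //; lra.
Qed.

Lemma titu_tight s t p q : 0 < p -> 0 < q -> (s + t) ^+ 2 = 1 ->
  s ^+ 2 / p + t ^+ 2 / q <= (p + q)^-1 -> q * s = p * t.
Proof.
move=> p0 q0 st; rewrite -subr_le0.
have -> : s ^+ 2 / p + t ^+ 2 / q - (p + q)^-1 = (q * s - p * t) ^+ 2 / (p * q * (p + q)).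
  rewrite -[(p + q)^-1]mul1r -st; field.
  by do ?(apply/andP; split); apply/eqP; lra.
rewrite pmulr_lle0 ?invr_gt0 ?mulr_gt0 ?addr_gt0 // => h.
by apply/eqP; rewrite -subr_eq0 -sqrf_eq0 eq_le h sqr_ge0.
Qed.

(** Weights p and q that bound the energy x + y below and the gain through their
    inverses give the comparison, by the Cauchy-Schwarz inequality. *)
Lemma weigh_pairs x y p q g : 0 < x -> 0 < y -> 0 < p -> 0 < q ->
  (p^-1 + q^-1) / 4 <= g -> p * x ^+ 2 + q * y ^+ 2 < x + y -> x + y < 4 * g.
Proof.
move=> x0 y0 p0 q0 hg hE; have xy0 : 0 < x + y by lra.
have tt : (x + y) ^+ 2 <= (p^-1 + q^-1) * (p * x ^+ 2 + q * y ^+ 2).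
  rewrite -subr_ge0.
  have -> : (p^-1 + q^-1) * (p * x ^+ 2 + q * y ^+ 2) - (x + y) ^+ 2
     = (p * x - q * y) ^+ 2 / (p * q).
    by field; apply/andP; split; apply/eqP; lra.
  by rewrite divr_ge0 ?sqr_ge0 // mulr_ge0 //; lra.
have s0 : 0 < p^-1 + q^-1 by rewrite addr_gt0 ?invr_gt0.
apply: (@lt_le_trans _ _ (p^-1 + q^-1)); last by lra.
rewrite -(ltr_pM2r xy0) -expr2; apply: le_lt_trans tt _.
by rewrite ltr_pM2l.
Qed.

End Elementary.

Section Branches.
Variables (R : realType) (G : sgraph).
Implicit Types (P Q t h : G) (om i : G -> G -> R) (x y : R).

Lemma energy_ge2 om P Q : circulation om -> Q != P ->
  sqr_at om P + rest om Q [:: P] <= energy om.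
Proof.
move=> [omN _] QP; rewrite (energy_del P omN) lerD2l.
rewrite -rest_del // -rest0; apply: energy_ge_sqr_at; exact: del_atN.
Qed.

Lemma energy_ge3 om P Q Q' : circulation om -> Q != P -> Q' != P -> Q' != Q ->
  sqr_at om P + rest om Q [:: P] + rest om Q' [:: P; Q] <= energy om.
Proof.
move=> [omN _] QP Q'P Q'Q; rewrite (energy_del P omN) -addrA lerD2l.
have dN := del_atN P omN.
rewrite (energy_del Q dN) rest0 rest_del // lerD2l.
rewrite -(rest_del _ _ Q'P) -(rest_del _ _ Q'Q) -rest0.
by apply: energy_ge_sqr_at; exact: del_atN.
Qed.

(** The two ends (t1, h1) and (t2, h2) of the chain of an edge that carries the
    circulating current x towards h1. In the first alternative of the last field
    the chain is a single edge. *)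
Record branch_pair om i x t1 h1 t2 h2 : Prop := BranchPair {
  bp_adj1 : adj t1 h1;
  bp_adj2 : adj t2 h2;
  bp_deg1 : (2 < deg h1)%N;
  bp_deg2 : (2 < deg h2)%N;
  bp_circ1 : om h1 t1 = - x;
  bp_circ2 : om h2 t2 = x;
  bp_flow : (i h1 t1 + i h2 t2) ^+ 2 = 1;
  bp_distinct : (t1, h1) <> (t2, h2);
  bp_tails : (t1 = h2 /\ t2 = h1) \/ (deg t1 = 2 /\ deg t2 = 2) }.

Lemma branch_pair_rev om i x t1 h1 t2 h2 :
  branch_pair om i x t1 h1 t2 h2 -> branch_pair om i (- x) t2 h2 t1 h1.
Proof.
case=> *; split=> //; rewrite ?opprK 1?[i h2 t2 + _]addrC //; first by apply/nesym.
by tauto.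
Qed.

Lemma degR h : (2 < deg h)%N -> 3 <= (deg h)%:R :> R.
Proof. by rewrite ler_nat. Qed.

Section Pair.
Variables (om i : G -> G -> R) (x : R) (t1 h1 t2 h2 : G).
Hypotheses (co : circulation om) (i0 : conserved i).
Hypothesis bp : branch_pair om i x t1 h1 t2 h2.

Lemma bp_adj1' : adj h1 t1. Proof. by rewrite adj_sym (bp_adj1 bp). Qed.
Lemma bp_adj2' : adj h2 t2. Proof. by rewrite adj_sym (bp_adj2 bp). Qed.

(** Either the chain is the edge h1h2 and the current x has to spread over the
    other edges at h2, or its last edge is not incident with h1. *)
Lemma bp_rest : x ^+ 2 / ((deg h2)%:R - 1) <= rest om h2 [:: h1].
Proof.
have d2 := degR (bp_deg2 bp).
case: (bp_tails bp) => [[_ t2h1]|[_ dt2]].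
  have := @rest_ge_card _ _ om h2 [:: t2] (co.2 h2) isT.
  rewrite /= bp_adj2' big_seq1 (bp_circ2 bp) t2h1 => /(_ isT) h.
  by rewrite ler_pdivrMr ?[_ * (_ - _)]mulrC //; lra.
have t2P : t2 \notin [:: h1].
  rewrite inE; apply: contra_eqN dt2 => /eqP ->.
  by have := bp_deg1 bp; case: (deg h1) => [|[|[|]]].
apply: le_trans (rest_ge om bp_adj2' t2P); rewrite (bp_circ2 bp).
by rewrite ler_pdivrMr ?ler_peMr ?sqr_ge0 //; lra.
Qed.

Lemma bp_loop_tails : h1 = h2 -> deg t1 = 2 /\ deg t2 = 2.
Proof.
move=> h12; case: (bp_tails bp) => // -[t1E _].
by have := bp_adj1 bp; rewrite t1E h12 adj_irrefl.
Qed.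

End Pair.

Lemma deg2_neq t h : deg t = 2 -> (2 < deg h)%N -> t != h.
Proof. by move=> dt; apply: contraTneq => <-; rewrite dt. Qed.

Lemma vertex_gain_ge2 i h t t' : conserved i -> (2 < deg h)%N ->
  adj h t -> adj h t' -> t' != t ->
  (i h t ^+ 2 + i h t' ^+ 2) / (2 + 4 / ((deg h)%:R - 2)) <= vertex_gain i h.
Proof.
move=> i0 d3 ht ht' tt'; have dR := degR d3.
rewrite vertex_gainE // ler_pM2r; last first.
  by rewrite invr_gt0 addr_gt0 // divr_gt0 //; lra.
rewrite rest0 (rest_cons i ht) // lerD2l.
by apply: rest_ge; rewrite ?inE.
Qed.

(** The currents from h towards P and towards Q have the same sign, so that their
    sum, which has to enter h along the remaining edges, is at least the first. *)
Lemma rest_skip om P Q h : circulation om -> (2 < deg h)%N -> adj h P ->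
  0 <= om h P -> Q != P -> (adj h Q -> 0 <= om h Q) ->
  om h P ^+ 2 * ((deg h)%:R - 1)^-1 <= rest om h [:: P; Q].
Proof.
move=> co d3 hP o0 QP oQ; have dR := degR d3.
have [hQ|hQ] := boolP (adj h Q).
  have uq : uniq [:: P; Q] by rewrite /= inE andbT eq_sym.
  have := rest_ge_card (co.2 h) uq; rewrite /= hP hQ !big_cons big_nil => /(_ isT).
  have := oQ hQ; set q := om h Q; set p := om h P in o0 *; set r := rest _ _ _ => q0 k.
  have r0 : 0 <= r by exact: rest_ge0.
  have : p ^+ 2 <= (p + (q + 0)) ^+ 2 by rewrite addr0 lerXn2r ?nnegrE ?lerDl ?addr_ge0.
  by move=> k2; rewrite ler_pdivrMr; lra.
have := @rest_ge_card _ _ om h [:: P] (co.2 h) isT; rewrite /= hP big_seq1 => /(_ isT).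
rewrite ler_pdivrMr 1?[_ * (_ - 1)]mulrC; last by lra.
have -> // : rest om h [:: P] = rest om h [:: P; Q].
apply: eq_bigl => z; rewrite !inE; case: (eqVneq z Q) => [->|]; last by rewrite orbF.
by rewrite (negPf hQ).
Qed.

(** The chains of the two edges meet at the branching vertex P. Reversing the
    edges if need be, both carry current of the circulation om into P, and then
    the other edges at P have to carry x + y. *)
Section Shared.
Variables (om i : G -> G -> R) (x y : R) (P t1 t4 : G).
Hypotheses (co : circulation om) (i0 : conserved i).
Hypotheses (Eom : energy om = x + y) (x0 : 0 < x) (y0 : 0 < y) (t14 : t1 != t4).

Let X : R := ((deg P)%:R - 2)^-1.

Section OnePair.
Variables (t2 Q t3 Q' : G).
Hypotheses (bp1 : branch_pair om i x t1 P t2 Q) (bp2 : branch_pair om i y t4 P t3 Q').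

Lemma shared_deg : 3 <= (deg P)%:R :> R. Proof. exact: degR (bp_deg1 bp1). Qed.

Lemma shared_X : 0 < X /\ X <= 1.
Proof.
have dP := shared_deg; rewrite /X; split; first by rewrite invr_gt0; lra.
by rewrite invf_le1; lra.
Qed.

Lemma shared_sqr_at : x ^+ 2 + y ^+ 2 + X * (x + y) ^+ 2 <= sqr_at om P.
Proof.
have dP := shared_deg; have a1 := bp_adj1' bp1; have a4 := bp_adj1' bp2.
have n41 : t4 \notin [:: t1] by rewrite inE eq_sym.
rewrite rest0 (rest_cons om a1) // (rest_cons om a4 n41) addrA.
rewrite (bp_circ1 bp1) (bp_circ1 bp2) !sqrrN lerD2l.
have := @rest_ge_card _ _ om P [:: t4; t1] (co.2 P).
rewrite /= a1 a4 inE eq_sym t14 big_cons big_seq1 (bp_circ1 bp1) (bp_circ1 bp2).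
move=> /(_ isT isT) h; rewrite /X mulrC ler_pdivrMr; last by lra.
by rewrite [rest _ _ _ * _]mulrC; apply: le_trans h; rewrite -opprD sqrrN addrC.
Qed.

(** If both chains are single edges, then QQ' may be an edge. It is counted at the
    vertex where its current has the sign that lowers the remaining flow, and the
    other vertex manages without it. *)
Lemma shared_distinct : Q != P -> Q' != P -> Q != Q' -> x + y < 4 * gain i.
Proof.
move=> QP Q'P QQ'; have [X0 X1] := shared_X.
have dQ := degR (bp_deg2 bp1); have dQ' := degR (bp_deg2 bp2).
pose b : R := ((deg Q)%:R - 1)^-1; pose b' : R := ((deg Q')%:R - 1)^-1.
have b0 : 0 < b by rewrite invr_gt0; lra.
have b'0 : 0 < b' by rewrite invr_gt0; lra.
apply: (@weigh_pairs _ x y (1 + X + b) (1 + X + b')) => //; try by lra.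
  have uq : uniq [:: P; Q; Q'] by rewrite /= !inE !negb_or ![P == _]eq_sym QP Q'P QQ'.
  apply: le_trans (gain_ge i0 uq); rewrite !big_cons big_nil addr0.
  have := vertex_gain_ge2 i0 (bp_deg1 bp1) (bp_adj1' bp1) (bp_adj1' bp2) (_ : t4 != t1).
  rewrite eq_sym t14 -/X => /(_ isT).
  have := vertex_gain_ge1 i0 (bp_deg2 bp1) (bp_adj2' bp1).
  have := vertex_gain_ge1 i0 (bp_deg2 bp2) (bp_adj2' bp2).
  rewrite -/b -/b'.
  have e0 : 0 < 2 + 4 * X by lra.
  have e1 : 0 < 2 + 4 * b by lra.
  have e2 : 0 < 2 + 4 * b' by lra.
  have := titu e0 e1 (bp_flow bp1); have := titu e0 e2 (bp_flow bp2).
  have -> : 2 + 4 * X + (2 + 4 * b) = 4 * (1 + X + b) by ring.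
  have -> : 2 + 4 * X + (2 + 4 * b') = 4 * (1 + X + b') by ring.
  by rewrite !invfM !mulrDl; lra.
have xy : 0 < x * y by exact: mulr_gt0.
have hP := shared_sqr_at.
have Xxy : 0 < X * (x * y) by exact: mulr_gt0.
suff [h|h] : b * x ^+ 2 + b' * y ^+ 2 <= rest om Q [:: P] + rest om Q' [:: P; Q]
    \/ b * x ^+ 2 + b' * y ^+ 2 <= rest om Q' [:: P] + rest om Q [:: P; Q'].
- have QQ2 : Q' != Q by rewrite eq_sym.
  by have := energy_ge3 co QP Q'P QQ2; rewrite Eom; lra.
- by have := energy_ge3 co Q'P QP QQ'; rewrite Eom; lra.
have rQ := bp_rest co bp1; have rQ' := bp_rest co bp2.
rewrite [_ / _]mulrC -/b in rQ; rewrite [_ / _]mulrC -/b' in rQ'.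
have b1 : b <= 1 by rewrite invf_le1; lra.
have b'1 : b' <= 1 by rewrite invf_le1; lra.
have bx : b * x ^+ 2 <= x ^+ 2 by rewrite ler_piMl ?sqr_ge0.
have by' : b' * y ^+ 2 <= y ^+ 2 by rewrite ler_piMl ?sqr_ge0.
case: (bp_tails bp2) => [[_ t3P]|[_ dt3]]; last first.
  left; have : t3 \notin [:: P; Q].
    by rewrite !inE negb_or !(deg2_neq dt3) ?(bp_deg1 bp1) ?(bp_deg2 bp1).
  by move=> /(rest_ge om (bp_adj2' bp2)); rewrite (bp_circ2 bp2); lra.
case: (bp_tails bp1) => [[_ t2P]|[_ dt2]]; last first.
  right; have : t2 \notin [:: P; Q'].
    by rewrite !inE negb_or !(deg2_neq dt2) ?(bp_deg1 bp1) ?(bp_deg2 bp2).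
  by move=> /(rest_ge om (bp_adj2' bp1)); rewrite (bp_circ2 bp1); lra.
have a2 : adj Q P by rewrite -t2P (bp_adj2' bp1).
have a3 : adj Q' P by rewrite -t3P (bp_adj2' bp2).
have c2 : om Q P = x by rewrite -t2P (bp_circ2 bp1).
have c3 : om Q' P = y by rewrite -t3P (bp_circ2 bp2).
have o2 : 0 <= om Q P by rewrite c2 ltW.
have o3 : 0 <= om Q' P by rewrite c3 ltW.
have [r0|r0] := leP 0 (om Q' Q).
  left; have := rest_skip co (bp_deg2 bp2) a3 o3 QP (fun _ => r0).
  by rewrite c3 -/b'; lra.
have r1 : 0 <= om Q Q' by rewrite co.1 oppr_ge0 ltW.
right; have := rest_skip co (bp_deg2 bp1) a2 o2 Q'P (fun _ => r1).
by rewrite c2 -/b; lra.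
Qed.

(** Both chains join P to Q. The edges at Q carry x + y once more, unless some of
    them join Q to P; if both chains are longer than one edge, their last edges
    make up for this. *)
Lemma shared_both : Q = Q' -> Q != P -> t2 != t3 -> x + y < 4 * gain i.
Proof.
move=> QQ' QP t23; have [X0 X1] := shared_X.
have dQ := degR (bp_deg2 bp1); pose Y : R := ((deg Q)%:R - 2)^-1.
have Y0 : 0 < Y by rewrite invr_gt0; lra.
have Y1 : Y <= 1 by rewrite invf_le1; lra.
have a2 := bp_adj2' bp1; have c2 := bp_circ2 bp1.
have a3 := bp_adj2' bp2; have c3 := bp_circ2 bp2; rewrite -QQ' in a3 c3.
apply: (@weigh_pairs _ x y (1 + X + Y) (1 + X + Y)) => //; try by lra.
  have uq : uniq [:: P; Q] by rewrite /= !inE andbT eq_sym.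
  apply: le_trans (gain_ge i0 uq); rewrite !big_cons big_nil addr0.
  have := vertex_gain_ge2 i0 (bp_deg1 bp1) (bp_adj1' bp1) (bp_adj1' bp2) (_ : t4 != t1).
  rewrite eq_sym t14 -/X => /(_ isT).
  have := vertex_gain_ge2 i0 (bp_deg2 bp1) a2 a3 (_ : t3 != t2).
  rewrite eq_sym t23 -/Y => /(_ isT).
  have e0 : 0 < 2 + 4 * X by lra.
  have e1 : 0 < 2 + 4 * Y by lra.
  have := titu e0 e1 (bp_flow bp1); have := titu e0 e1 (bp_flow bp2); rewrite -QQ'.
  have -> : 2 + 4 * X + (2 + 4 * Y) = 4 * (1 + X + Y) by ring.
  by rewrite !invfM !mulrDl; lra.
have xy : 0 < x * y by exact: mulr_gt0.
have Xxy : 0 < X * (x * y) by exact: mulr_gt0.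
have Yxy : 0 < Y * (x * y) by exact: mulr_gt0.
have hP := shared_sqr_at; have := energy_ge2 co QP; rewrite Eom.
have Yx : Y * x ^+ 2 <= x ^+ 2 by rewrite ler_piMl ?sqr_ge0.
have Yy : Y * y ^+ 2 <= y ^+ 2 by rewrite ler_piMl ?sqr_ge0.
(* The edges at Q other than its two chains also carry x + y. *)
have restQ : Y * (x + y) ^+ 2 <= rest om Q [:: t3; t2].
  have := @rest_ge_card _ _ om Q [:: t3; t2] (co.2 Q).
  rewrite /= a2 a3 inE eq_sym t23 big_cons big_seq1 c2 c3 => /(_ isT isT) h.
  rewrite mulrC ler_pdivrMr; last by lra.
  by rewrite [rest _ _ _ * _]mulrC [x + y]addrC.
case: (bp_tails bp1) => [[_ t2P]|[_ dt2]].
  have n : t3 \notin [:: P] by rewrite inE -t2P eq_sym.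
  have eP : rest om Q [:: t3; P] = rest om Q [:: t3; t2] by rewrite t2P.
  by rewrite (rest_cons om a3 n) c3 eP; have := sqr_ge0 y; lra.
case: (bp_tails bp2) => [[_ t3P]|[_ dt3]].
  have n : t2 \notin [:: P] by rewrite inE -t3P.
  rewrite (rest_cons om a2 n) c2.
  have -> : rest om Q [:: t2; P] = rest om Q [:: t3; t2].
    by rewrite -t3P; apply: eq_bigl => z; rewrite !inE orbC.
  by have := sqr_ge0 x; lra.
have n3 : t3 \notin [:: P] by rewrite inE (deg2_neq dt3) ?(bp_deg1 bp1).
have n2 : t2 \notin [:: t3; P].
  by rewrite !inE negb_or t23 (deg2_neq dt2) ?(bp_deg1 bp1).
rewrite (rest_cons om a3 n3) (rest_cons om a2 n2) c2 c3.
by have := rest_ge0 om Q [:: t2; t3; P]; lra.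
Qed.

(** A loop at P brings no net current, so y has to leave P along the deg P - 3
    edges outside the chains; in particular deg P is at least 4. *)
Lemma shared_loop : Q = P -> Q' != P -> t2 != t4 -> x + y < 4 * gain i.
Proof.
move=> QP Q'P t24; have dP := shared_deg.
have a1 := bp_adj1' bp1; have c1 := bp_circ1 bp1.
have a2 := bp_adj2' bp1; have c2 := bp_circ2 bp1; rewrite QP in a2 c2.
have a4 := bp_adj1' bp2; have c4 := bp_circ1 bp2.
have t12 : t1 != t2 by apply/eqP => t12; apply: (bp_distinct bp1); rewrite t12 QP.
have u3 : uniq [:: t4; t2; t1] by rewrite /= !inE negb_or !(eq_sym t4) t14 t24 eq_sym t12.
have al3 : all (@adj G P) [:: t4; t2; t1] by rewrite /= a1 a2 a4.
have := rest_ge_card (co.2 P) u3 al3; rewrite !big_cons big_nil c1 c2 c4 /= => h3.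
have d4 : 4 <= (deg P)%:R :> R.
  have [d3|] := eqVneq (deg P) 3; last first.
    by move=> n3; rewrite ler_nat ltn_neqAle eq_sym n3 (bp_deg1 bp1).
  by move: h3; rewrite d3 subrr mul0r; have := exprn_gt0 2 y0; lra.
have [X0 _] := shared_X.
have Xle : X <= 2^-1 by rewrite lef_pV2 ?posrE; lra.
have XZ : X < ((deg P)%:R - 3)^-1 by rewrite ltf_pV2 ?posrE; lra.
set Z := _^-1 in XZ.
have dQ' := degR (bp_deg2 bp2); pose b' : R := ((deg Q')%:R - 1)^-1.
have b'0 : 0 < b' by rewrite invr_gt0; lra.
have n2 : t2 \notin [:: t1] by rewrite inE eq_sym.
have n4 : t4 \notin [:: t2; t1] by rewrite !inE negb_or !(eq_sym t4) t24 t14.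
apply: (@weigh_pairs _ x y (1 + 2 * X) (1 + X + b')) => //; try by lra.
  have uq : uniq [:: P; Q'] by rewrite /= !inE andbT eq_sym.
  apply: le_trans (gain_ge i0 uq); rewrite !big_cons big_nil addr0.
  have e0 : 0 < 2 + 4 * X by lra.
  have e2 : 0 < 2 + 4 * b' by lra.
  have g1 : (i P t1 ^+ 2 + i P t2 ^+ 2 + i P t4 ^+ 2) / (2 + 4 * X) <= vertex_gain i P.
    rewrite vertex_gainE ?(bp_deg1 bp1) // -/X ler_pM2r ?invr_gt0 //.
    rewrite rest0 (rest_cons i a1) // (rest_cons i a2) // (rest_cons i a4) //.
    by have := rest_ge0 i P [:: t4; t2; t1]; lra.
  have := vertex_gain_ge1 i0 (bp_deg2 bp2) (bp_adj2' bp2); rewrite -/b'.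
  have := titu e0 e0 (bp_flow bp1); have := titu e0 e2 (bp_flow bp2); rewrite QP.
  have -> : 2 + 4 * X + (2 + 4 * b') = 4 * (1 + X + b') by ring.
  have -> : 2 + 4 * X + (2 + 4 * X) = 4 * (1 + 2 * X) by ring.
  by move: g1; rewrite !invfM !mulrDl; lra.
have := energy_ge2 co Q'P; rewrite Eom; have := bp_rest co bp2.
rewrite rest0 (rest_cons om a1) // (rest_cons om a2) // (rest_cons om a4) // c1 c2 c4.
have : Z * y ^+ 2 <= rest om P [:: t4; t2; t1].
  rewrite /Z mulrC ler_pdivrMr; last by lra.
  by move: h3; set r := rest _ _ _; lra.
have : X * y ^+ 2 < Z * y ^+ 2 by rewrite ltr_pM2r ?exprn_gt0.
have : X * x ^+ 2 <= 2^-1 * x ^+ 2 by rewrite ler_wpM2r ?sqr_ge0.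
by rewrite [_ / (_ - 1)]mulrC -/b'; lra.
Qed.

End OnePair.

(** Both chains are loops at P. The edge beyond t1 makes the bound strict. *)
Lemma shared_loops t2 t3 : branch_pair om i x t1 P t2 P -> branch_pair om i y t4 P t3 P ->
  t2 != t4 -> t1 != t3 -> t2 != t3 -> x + y < 4 * gain i.
Proof.
move=> bp1 bp2 t24 t13 t23; have dP := shared_deg bp1.
have a1 := bp_adj1' bp1; have c1 := bp_circ1 bp1.
have a2 := bp_adj2' bp1; have c2 := bp_circ2 bp1.
have a3 := bp_adj2' bp2; have c3 := bp_circ2 bp2.
have a4 := bp_adj1' bp2; have c4 := bp_circ1 bp2.
have t12 : t1 != t2 by apply/eqP => t12; apply: (bp_distinct bp1); rewrite t12.
have t43 : t4 != t3 by apply/eqP => t43; apply: (bp_distinct bp2); rewrite t43.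
have n2 : t2 \notin [:: t1] by rewrite inE eq_sym.
have n4 : t4 \notin [:: t2; t1] by rewrite !inE negb_or !(eq_sym t4) t24 t14.
have n3 : t3 \notin [:: t4; t2; t1].
  by rewrite !inE !negb_or !(eq_sym t3) t43 t23 t13.
have d4 : 4 <= (deg P)%:R :> R.
  rewrite ler_nat; apply: (@leq_trans #|[:: t3; t4; t2; t1]|).
    by rewrite (card_uniqP _) //= n3 n4 n2.
  apply: subset_leq_card; apply/subsetP => t; rewrite !inE.
  by move=> /or4P[]/eqP ->; [exact: a3 | exact: a4 | exact: a2 | exact: a1].
have [X0 _] := shared_X bp1.
have Xle : X <= 2^-1 by rewrite lef_pV2 ?posrE; lra.
apply: (@weigh_pairs _ x y (1 + 2 * X) (1 + 2 * X)) => //; try by lra.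
  have uq : uniq [:: P] by [].
  apply: le_trans (gain_ge i0 uq); rewrite big_seq1.
  have e0 : 0 < 2 + 4 * X by lra.
  rewrite vertex_gainE ?(bp_deg1 bp1) // -/X.
  have := titu e0 e0 (bp_flow bp1); have := titu e0 e0 (bp_flow bp2).
  have -> : 2 + 4 * X + (2 + 4 * X) = 4 * (1 + 2 * X) by ring.
  have : (i P t1 ^+ 2 + i P t2 ^+ 2 + i P t4 ^+ 2 + i P t3 ^+ 2) / (2 + 4 * X)
      <= sqr_at i P / (2 + 4 * X).
    rewrite ler_pM2r ?invr_gt0 //.
    rewrite rest0 (rest_cons i a1) // (rest_cons i a2) // (rest_cons i a4) //.
    by rewrite (rest_cons i a3) //; have := rest_ge0 i P [:: t3; t4; t2; t1]; lra.
  by rewrite !invfM !mulrDl; lra.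
have [dt1 _] := bp_loop_tails bp1 erefl.
have t1P : t1 != P by exact: deg2_neq dt1 (bp_deg1 bp1).
have [s [t1s sP _]] := deg2P dt1 (bp_adj1 bp1).
have := energy_ge2 co t1P; rewrite Eom.
have : x ^+ 2 <= rest om t1 [:: P].
  have o1 : om t1 s = - x.
    by rewrite (deg2_sum co.2 dt1 (bp_adj1 bp1) t1s sP) (co.1 P t1) c1; ring.
  by rewrite -(sqrrN x) -o1; apply: rest_ge; rewrite ?inE.
rewrite rest0 (rest_cons om a1) // (rest_cons om a2) // (rest_cons om a4) //.
rewrite (rest_cons om a3) // c1 c2 c3 c4.
have : X * x ^+ 2 <= 2^-1 * x ^+ 2 by rewrite ler_wpM2r ?sqr_ge0.
have : X * y ^+ 2 <= 2^-1 * y ^+ 2 by rewrite ler_wpM2r ?sqr_ge0.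
have := rest_ge0 om P [:: t3; t4; t2; t1]; have := exprn_gt0 2 x0.
by lra.
Qed.

End Shared.
End Branches.

(** * A single edge against the gain at its ends *)

Section Single.
Variables (R : realType) (G : sgraph).
Implicit Types (P Q t h p : G) (om i : G -> G -> R) (x : R).

(** Equality in the Cauchy-Schwarz inequality: the current splits evenly. *)
Lemma rest_tight om h t p : conserved om -> deg h = 3 -> adj h t -> adj h p -> p != t ->
  rest om h [:: t] <= om h t ^+ 2 / 2 -> om h p = - om h t / 2.
Proof.
move=> o0 d3 ht hp pt; have n : p \notin [:: t] by rewrite inE.
rewrite (rest_cons om hp n).
have := @rest_ge_card _ _ om h [:: p; t] (o0 h); rewrite /= ht hp inE pt d3.
rewrite big_cons big_seq1 => /(_ isT isT); set a := om h p; set b := om h t => k1 k2.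
have : (a + b / 2) ^+ 2 <= 0 by lra.
rewrite le_eqVlt ltNge sqr_ge0 orbF sqrf_eq0 => /eqP; lra.
Qed.

Lemma vertex_gain_tight i h t : conserved i -> (2 < deg h)%N -> adj h t -> i h t != 0 ->
  vertex_gain i h <= i h t ^+ 2 / (2 + 4 / ((deg h)%:R - 1)) ->
  deg h = 3 /\ forall p, adj h p -> p != t -> i h p = - i h t / 2.
Proof.
move=> i0 d3 ht nz; have d3R : 3 <= (deg h)%:R :> R by rewrite ler_nat.
have := rest_ge_card (s := [:: t]) (i0 h) isT; rewrite /= ht big_seq1 => /(_ isT).
have q0 : 0 < i h t ^+ 2 by rewrite lt_neqAle sqr_ge0 eq_sym sqrf_eq0 nz.
rewrite /vertex_gain rest0 (@rest_cons _ _ i h t [::] ht isT) => k1 k2.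
have dE : (deg h)%:R = 3 :> R.
  move: k1 k2 d3R q0; set d : R := (deg h)%:R; set r := rest _ _ _; set q := _ ^+ 2.
  move=> k1 + d3R q0; rewrite -subr_le0.
  have -> : (2^-1 - d^-1) * (q + r) - q / (2 + 4 / (d - 1))
      = ((d - 2) * (d + 1) * ((d - 1) * (q + r)) - q * (d - 1) * (d - 1) * d)
        / (2 * d * (d + 1) * (d - 1)).
    by field; do ?(apply/andP; split); apply/eqP; lra.
  rewrite pmulr_lle0; last by rewrite invr_gt0; do ?apply: mulr_gt0; lra.
  move=> k2; have k0 : 0 <= (d - 2) * (d + 1) by apply: mulr_ge0; lra.
  have rq : q * d <= (d - 1) * (q + r) by lra.
  have qd : 0 < q * d by apply: mulr_gt0 => //; lra.
  have k3 : (q * d) * (d - 3) <= 0 by have := ler_wpM2l k0 rq; lra.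
  by move: k3; rewrite pmulr_rle0 //; lra.
have dN : deg h = 3 by apply/eqP; rewrite -(eqr_nat R) dE.
split=> // p hp pt; apply: rest_tight => //; move: k2; rewrite dE.
have -> : 2 + 4 / (3 - 1) = 4 :> R by field.
by lra.
Qed.

(** The ends of a chain coincide if the chain is a loop, and count once then. *)
Definition pair_gain i h1 h2 := \sum_(h <- undup [:: h1; h2]) vertex_gain i h.

Lemma pair_gain_loop i h : pair_gain i h h = vertex_gain i h.
Proof. by rewrite /pair_gain /= inE eqxx big_seq1. Qed.

Lemma pair_gain_neq i h1 h2 : h1 != h2 ->
  pair_gain i h1 h2 = vertex_gain i h1 + vertex_gain i h2.
Proof. by move=> /negPf n; rewrite /pair_gain /= inE n big_cons big_seq1. Qed.

Section Fixed.
Variables (om i : G -> G -> R) (x : R) (t1 h1 t2 h2 : G).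
Hypotheses (co : circulation om) (i0 : conserved i).
Hypothesis bp : branch_pair om i x t1 h1 t2 h2.
Hypotheses (Eom : energy om = x) (x0 : 0 < x).

(** A chain of at least two edges carries the current x at least twice, so that x
    is at most 1/2. *)
Lemma single_far : deg t1 = 2 -> deg t2 = 2 -> x < 4 * pair_gain i h1 h2.
Proof.
move=> dt1 dt2; have a1 := bp_adj1' bp; have a2 := bp_adj2' bp.
have d1 := degR R (bp_deg1 bp); have d2 := degR R (bp_deg2 bp).
have [E|h12] := eqVneq h1 h2.
  move: bp a2; rewrite -E pair_gain_loop => bp' a2.
  have t12 : t1 != t2 by apply/eqP => e; apply: (bp_distinct bp'); rewrite e.
  have n2 : t2 \notin [:: t1] by rewrite inE eq_sym.
  have := energy_ge_sqr_at h1 co.1; rewrite Eom.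
  rewrite rest0 (rest_cons om a1) // (rest_cons om a2) // (bp_circ1 bp') (bp_circ2 bp').
  have := rest_ge0 om h1 [:: t2; t1] => r0 k.
  have : x * (1 - 2 * x) >= 0 by lra.
  rewrite pmulr_rge0 // => x2.
  have := @rest_ge_card _ _ i h1 [:: t2; t1] (i0 h1).
  rewrite /= a1 a2 inE eq_sym t12 big_cons big_seq1 addrC (bp_flow bp') => /(_ isT isT) k1.
  rewrite vertex_gainE ?(bp_deg1 bp) // rest0 (rest_cons i a1) // (rest_cons i a2) //.
  have := bp_flow bp'; set s := i h1 t1; set s' := i h1 t2 => ss.
  have sg : s ^+ 2 + s' ^+ 2 >= 2^-1 by have := sqr_ge0 (s - s'); lra.
  move: k1 d1; set d : R := (deg h1)%:R; set r := rest _ _ _ => k1 d3.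
  have -> : (s ^+ 2 + (s' ^+ 2 + r)) / (2 + 4 / (d - 2))
      = (s ^+ 2 + s' ^+ 2 + r) * (d - 2) / (2 * d).
    by field; do ?(apply/andP; split); apply/eqP; lra.
  rewrite mulrA ltr_pdivlMr; last by lra.
  have : 2^-1 * (d - 2) <= (s ^+ 2 + s' ^+ 2) * (d - 2) by rewrite ler_wpM2r //; lra.
  have : x * (2 * d) <= d by rewrite mulrCA mulrA ler_piMl //; lra.
  by lra.
rewrite pair_gain_neq //.
have t2h1 : t2 \notin [:: h1] by rewrite inE (deg2_neq dt2) ?(bp_deg1 bp).
have h21 : h2 != h1 by rewrite eq_sym.
have := energy_ge2 co h21; rewrite Eom.
have := rest_ge om a2 t2h1; rewrite (bp_circ2 bp).
have := @rest_ge_card _ _ om h1 [:: t1] (co.2 h1) isT; rewrite /= a1 big_seq1 => /(_ isT).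
rewrite rest0 (@rest_cons _ _ om h1 t1 [::] a1 isT) (bp_circ1 bp) sqrrN.
set r := rest om h1 _; set r' := rest om h2 _ => k1 k2 k3.
have x2 : 0 < x ^+ 2 by exact: exprn_gt0.
have r0 : 0 < r.
  have : 0 < ((deg h1)%:R - 1) * r by apply: lt_le_trans k1.
  by rewrite pmulr_rgt0 //; lra.
have : 0 < x * (1 - 2 * x) by lra.
rewrite pmulr_rgt0 // => xlt.
have g h t : (2 < deg h)%N -> adj h t -> i h t ^+ 2 / 4 <= vertex_gain i h.
  move=> d3 ht; apply: le_trans (vertex_gain_ge1 i0 d3 ht).
  have dR := degR R d3; rewrite ler_wpM2l ?sqr_ge0 // lef_pV2 ?posrE //; last first.
    by rewrite addr_gt0 // divr_gt0 //; lra.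
  suff : 4 / ((deg h)%:R - 1) <= 2 :> R by lra.
  by rewrite ler_pdivrMr; lra.
have := g _ _ (bp_deg1 bp) a1; have := g _ _ (bp_deg2 bp) a2.
have := bp_flow bp; have := sqr_ge0 (i h1 t1 - i h2 t2); lra.
Qed.

Section Near.
Hypotheses (t1E : t1 = h2) (t2E : t2 = h1).

Let a : R := ((deg h1)%:R - 1)^-1.
Let b : R := ((deg h2)%:R - 1)^-1.

Lemma near_adj : [/\ adj h1 h2, adj h2 h1 & h1 != h2].
Proof.
have a1 := bp_adj1' bp; rewrite t1E in a1.
by split=> //; [rewrite adj_sym | exact: adj_neq].
Qed.

Lemma near_pos : 0 < a /\ 0 < b.
Proof.
by have := degR R (bp_deg1 bp); have := degR R (bp_deg2 bp); rewrite !invr_gt0; lra.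
Qed.

Lemma near_energy : x * (1 + a + b) <= 1.
Proof.
have [a12 a21 h12] := near_adj; have h21 : h2 != h1 by rewrite eq_sym.
have d1 := degR R (bp_deg1 bp).
have := energy_ge2 co h21; rewrite Eom.
have := bp_rest co bp.
have := @rest_ge_card _ _ om h1 [:: h2] (co.2 h1) isT; rewrite /= a12 big_seq1 => /(_ isT).
have := bp_circ1 bp; rewrite t1E => c1.
rewrite rest0 (@rest_cons _ _ om h1 h2 [::] a12 isT) c1 sqrrN mulrC -ler_pdivrMr; last by lra.
rewrite -/a -/b => k1 k2 k3.
by rewrite -(ler_pM2l x0); lra.
Qed.

Lemma near_titu : (4 * (1 + a + b))^-1
  <= i h1 h2 ^+ 2 / (2 + 4 * a) + i h2 h1 ^+ 2 / (2 + 4 * b).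
Proof.
have [a0 b0] := near_pos.
have -> : 4 * (1 + a + b) = 2 + 4 * a + (2 + 4 * b) by ring.
by apply: titu; [lra | lra | have := bp_flow bp; rewrite t1E t2E].
Qed.

Lemma near_x : x / 4 <= (4 * (1 + a + b))^-1.
Proof.
have [a0 b0] := near_pos; have := near_energy.
by rewrite -ler_pdivlMr ?invfM ?div1r; [lra | lra].
Qed.

(** The current x has to spread over the other edges at both ends, and so has i;
    the same number 1 + a + b bounds x above and the gain below. *)
Lemma single_near : x <= 4 * pair_gain i h1 h2.
Proof.
have [a12 a21 h12] := near_adj; rewrite pair_gain_neq //.
have := vertex_gain_ge1 i0 (bp_deg1 bp) a12; have := vertex_gain_ge1 i0 (bp_deg2 bp) a21.
by have := near_titu; have := near_x; rewrite -/a -/b; lra.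
Qed.

(** Equality forces the picture of two opposite edges of K_4: both ends have
    degree 3, current splits evenly, and the ends have the same neighbours. *)
Lemma single_tight : 4 * pair_gain i h1 h2 <= x ->
  [/\ deg h1 = 3, deg h2 = 3, i h1 h2 = i h2 h1, i h1 h2 != 0 &
    (forall p, adj h1 p -> p != h2 -> adj h2 p /\ i h1 p = - i h1 h2 / 2) /\
    (forall p, adj h2 p -> p != h1 -> adj h1 p /\ i h2 p = - i h2 h1 / 2)].
Proof.
have [a12 a21 h12] := near_adj; rewrite pair_gain_neq // => tight.
have [a0 b0] := near_pos.
have g1 := vertex_gain_ge1 i0 (bp_deg1 bp) a12; have g2 := vertex_gain_ge1 i0 (bp_deg2 bp) a21.
have T := near_titu; have X := near_x; rewrite -/a in g1; rewrite -/b in g2.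
have fl : (i h1 h2 + i h2 h1) ^+ 2 = 1 by have := bp_flow bp; rewrite t1E t2E.
have e0 : 0 < 2 + 4 * a by lra.
have e1 : 0 < 2 + 4 * b by lra.
have E : 4 * (1 + a + b) = 2 + 4 * a + (2 + 4 * b) by ring.
have prop : (2 + 4 * b) * i h1 h2 = (2 + 4 * a) * i h2 h1.
  by apply: titu_tight => //; rewrite -E; lra.
have nz1 : i h1 h2 != 0.
  apply/eqP => z1; move: prop; rewrite z1 mulr0 => /esym/eqP.
  by rewrite mulf_eq0 gt_eqF //= => /eqP z2; move: fl; rewrite z1 z2 addr0 expr0n /=; lra.
have nz2 : i h2 h1 != 0.
  apply: contraNneq nz1 => z2; move: prop; rewrite z2 mulr0 => /eqP.
  by rewrite mulf_eq0 gt_eqF.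
have [|d1 f1] := vertex_gain_tight i0 (bp_deg1 bp) a12 nz1; first by rewrite -/a; lra.
have [|d2 f2] := vertex_gain_tight i0 (bp_deg2 bp) a21 nz2; first by rewrite -/b; lra.
have aE : a = 2^-1 by rewrite /a d1; field.
have bE : b = 2^-1 by rewrite /b d2; field.
have xE : x = 2^-1.
  have e8 : 4 * (1 + a + b) = 8 by rewrite aE bE; lra.
  have e4 : 2 + 4 * a = 4 by rewrite aE; lra.
  have e4' : 2 + 4 * b = 4 by rewrite bE; lra.
  by rewrite e4 in g1 T; rewrite e4' in g2 T; rewrite e8 in T X; lra.
have ss : i h1 h2 = i h2 h1 by move: prop; rewrite aE bE; lra.
have c12 : om h1 h2 = - x by have := bp_circ1 bp; rewrite t1E.
have c21 : om h2 h1 = x by have := bp_circ2 bp; rewrite t2E.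
have h21 : h2 != h1 by rewrite eq_sym.
(* The energy of the circulation is used up by the edges at h1 and h2. *)
have dN := del_atN h1 co.1.
have := Eom; rewrite (energy_del h1 co.1) (energy_del h2 dN) rest0.
rewrite (@rest_cons _ _ om h1 h2 [::] a12 isT) rest0 rest_del // c12 sqrrN.
have := @rest_ge_card _ _ om h1 [:: h2] (co.2 h1) isT; rewrite /= a12 big_seq1 => /(_ isT).
have := @rest_ge_card _ _ om h2 [:: h1] (co.2 h2) isT; rewrite /= a21 big_seq1 => /(_ isT).
rewrite c12 c21 d1 d2 sqrrN; set r1 := rest om h1 _; set r2 := rest om h2 _.
set E2 := energy _ => k2 k1 k0.
have E2ge : 0 <= E2 by exact: energy_ge0.
have xx : x ^+ 2 = 4^-1 by rewrite xE; field.
have E20 : E2 <= 0 by lra.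
have r1x : r1 <= x ^+ 2 / 2 by lra.
have r2x : r2 <= x ^+ 2 / 2 by lra.
have away y z : adj y z -> y != h1 -> y != h2 -> z != h1 -> z != h2 -> om y z = 0.
  move=> yz y1 y2 z1 z2; have := energy_le0 (del_atN h2 dN) E20 yz.
  by rewrite /del_at (negPf y1) (negPf y2) (negPf z1) (negPf z2).
have common h h' p : [set h; h']%SET = [set h1; h2]%SET -> adj h p -> p != h' ->
    om h p != 0 -> adj h' p.
  move=> /set2_eq hh hp ph' nz; apply: contraNT nz => nh'.
  have ph : p != h by rewrite eq_sym adj_neq.
  have phA : adj p h by rewrite adj_sym.
  rewrite co.1 oppr_eq0; have /eqP := co.2 p; rewrite (bigD1 h) //= big1 ?addr0 //.
  move=> y /andP[py yh]; have yh' : y != h'.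
    by apply: contraNneq nh' => <-; rewrite adj_sym.
  by apply: away => //; case: hh ph ph' yh yh' => -[-> ->].
split=> //; split=> p hp pn; split.
- apply: (common h1) => //; rewrite (rest_tight co.2 d1 a12 hp pn) ?c12 ?sqrrN //.
  by rewrite opprK xE; apply/eqP; lra.
- exact: f1.
- apply: (common h2) => //; first by rewrite setUC.
  rewrite (rest_tight co.2 d2 a21 hp pn) ?c21 //.
  by rewrite xE; apply/eqP; lra.
- exact: f2.
Qed.

End Near.
End Fixed.
End Single.

(** * Comparison of one resistance of the line graph with the diameter of G *)

Section Compare.
Variables (R : realType) (G : sgraph).
Hypothesis Gc : connected_graph G.
Implicit Types (u v w z x y t h p : G) (om i : G -> G -> R) (m a b : G -> R).
Implicit Types e f : line_graph G.

Record two_edges u v w z m e f : Prop := TwoEdges {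
  te_uv : adj u v;
  te_wz : adj w z;
  te_neq : [set u; v]%SET != [set w; z]%SET;
  te_pot : averaged_potential u v w z m;
  te_e : val e = [set u; v]%SET;
  te_f : val f = [set w; z]%SET }.

Lemma two_edges_rev1 u v w z m e f :
  two_edges u v w z m e f -> two_edges v u w z m e f.
Proof.
case=> uv wz ef hm eE fE; split=> //.
- by rewrite adj_sym.
- by rewrite [X in X != _]setUC.
- by move=> x; rewrite hm; ring.
- by rewrite [RHS]setUC.
Qed.

Lemma two_edges_rev2 u v w z m e f :
  two_edges u v w z m e f -> two_edges u v z w m e f.
Proof.
case=> uv wz ef hm eE fE; split=> //.
- by rewrite adj_sym.
- by rewrite [X in _ != X]setUC.
- by move=> x; rewrite hm; ring.
- by rewrite [RHS]setUC.
Qed.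

Lemma acyclic_edge_rev u v : acyclic_edge R (u, v) -> acyclic_edge R (v, u).
Proof. by move=> ac om co; rewrite /= co.1 (ac om co) oppr0. Qed.

Lemma parallel_rev1 u v w z : parallel R (u, v) (w, z) -> parallel R (v, u) (w, z).
Proof.
case=> ag; [right | left] => om co; have := ag om co; rewrite /= => e;
  by rewrite co.1 e -co.1.
Qed.

Lemma parallel_sym u v w z : parallel R (u, v) (w, z) -> parallel R (w, z) (u, v).
Proof.
case=> ag; [left | right] => om co; have := ag om co; rewrite /= => e.
  by rewrite e.
by rewrite [RHS]co.1 e -co.1.
Qed.

Lemma midpoint_flow_neg u v w z i :
  midpoint_flow u v w z i -> midpoint_flow w z u v (fun x y => - i x y).
Proof.
by move=> [i0 i1]; split=> [x|x y xy]; rewrite ?sumrN ?i0 ?oppr0 // -opprD i1 // opprB.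
Qed.

Lemma midpoint_flow_rev1 u v w z i : midpoint_flow u v w z i -> midpoint_flow v u w z i.
Proof. by move=> [i0 i1]; split=> // x y xy; rewrite i1 // (edge_ind_swap _ u). Qed.

Lemma chain_end_neg u v t h i :
  chain_end (fun x y => - i x y) u v t h -> chain_end i u v t h.
Proof. by case=> *; split=> //; apply: oppr_inj. Qed.

Lemma chain_branch_pair om i u v t1 h1 t2 h2 : circulation om ->
  chain_end i u v t1 h1 -> chain_end i v u t2 h2 -> (i u v + i v u) ^+ 2 = 1 ->
  ~ acyclic_edge R (u, v) -> branch_pair om i (om u v) t1 h1 t2 h2.
Proof.
move=> co c1 c2 fl nac.
have ag1 := chain_end_circulation c1; have ag2 := chain_end_circulation c2.
split=> //.
- exact: chain_end_adj c1.
- exact: chain_end_adj c2.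
- exact: chain_end_deg c1.
- exact: chain_end_deg c2.
- by rewrite co.1 -(ag1 om co).
- by rewrite co.1 -(ag2 om co) /= -co.1.
- by rewrite (chain_end_flow c1) (chain_end_flow c2) addrC.
- move=> E; apply: nac => om' co'; have := ag1 om' co'; rewrite E -(ag2 om' co').
  by have := co'.1 u v; rewrite /=; lra.
- have d1 := chain_end_deg c1; have d2 := chain_end_deg c2.
  case: (chain_end_tail c1) => [[t1E h1E]|dt1]; case: (chain_end_tail c2) => [[t2E h2E]|dt2].
  + by left; rewrite t1E h1E t2E h2E.
  + have [du|/eqP du] := eqVneq (deg u) 2; first by right; rewrite t1E.
    have [t2E _] := chain_end_stop c2 du.
    by rewrite h1E -t2E dt2 in d1.
  + have [dv|/eqP dv] := eqVneq (deg v) 2; first by right; rewrite t2E.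
    have [t1E _] := chain_end_stop c1 dv.
    by rewrite h2E -t1E dt1 in d2.
  + by right.
Qed.

Lemma unit_current_rev u v a : unit_current_potential u v a ->
  unit_current_potential v u (fun t => - a t).
Proof.
move=> ha x; rewrite -[RHS]opprB -ha -sumrN.
by apply: eq_bigr => y _; rewrite opprD.
Qed.

Lemma pair_gain_le i h1 h2 : conserved i -> pair_gain i h1 h2 <= gain i.
Proof. by move=> i0; apply: gain_ge; rewrite ?undup_uniq. Qed.

Section Fixed.
Variables (u v w z : G) (m : G -> R) (e f : line_graph G).
Hypothesis te : two_edges u v w z m e f.
Let i := half_flow u v w z m.
Let uv := te_uv te.
Let wz := te_wz te.

Lemma te_midpoint : midpoint_flow u v w z i.
Proof. exact: half_flow_midpoint uv wz (te_pot te). Qed.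

Lemma te_conserved : conserved i. Proof. by case: te_midpoint. Qed.

Lemma te_flow_e : (i u v + i v u) ^+ 2 = 1.
Proof.
have [e1 e2 e3 e4] := edge_ind_uv R uv (te_neq te).
by have [_ ->] := te_midpoint; rewrite // e1 e3 sub0r sqrrN expr1n.
Qed.

Lemma te_flow_f : (i w z + i z w) ^+ 2 = 1.
Proof.
have ef : [set w; z]%SET != [set u; v]%SET by rewrite eq_sym (te_neq te).
have [e1 e2 e3 e4] := edge_ind_uv R wz ef.
by have [_ ->] := te_midpoint; rewrite // e1 e3 subr0 expr1n.
Qed.

Lemma edge_cycle_pos s t (c : G -> R) : adj s t -> unit_current_potential s t c ->
  ~ acyclic_edge R (s, t) -> 0 < edge_cycle s t c s t.
Proof.
move=> st hc nac; have E := energy_edge_cycle st hc.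
rewrite lt_neqAle -{2}E energy_ge0 andbT; apply/eqP => K0; apply: nac => om co.
have E0 : energy (edge_cycle s t c) = 0 by rewrite E.
have cc := edge_cycle_circulation st hc.
have z0 x y : adj x y -> edge_cycle s t c x y = 0.
  by apply: energy_le0 cc.1 _; rewrite E0.
have := circulation_pairing c st co.
rewrite (eq_dart_sum (F2 := fun _ _ => 0)); last by move=> x y /z0 ->; rewrite mulr0.
by rewrite /dart_sum big1 => [|x _]; [rewrite /=; lra | rewrite big1].
Qed.

Lemma edge_gain s t t1 h1 t2 h2 (c : G -> R) : adj s t -> unit_current_potential s t c ->
  (i s t + i t s) ^+ 2 = 1 ->
  chain_end i s t t1 h1 -> chain_end i t s t2 h2 -> ~ acyclic_edge R (s, t) ->
  edge_cycle s t c s t <= 4 * pair_gain i h1 h2.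
Proof.
move=> st hc fl c1 c2 nac; have co := edge_cycle_circulation st hc.
have bp := chain_branch_pair co c1 c2 fl nac.
have E := energy_edge_cycle st hc; have K0 := edge_cycle_pos st hc nac.
case: (bp_tails bp) => [[t1E t2E]|[dt1 dt2]].
  exact: single_near co te_conserved bp E K0 t1E t2E.
exact: ltW (single_far co te_conserved bp E K0 dt1 dt2).
Qed.

(** What equality means for an edge st whose ends both branch. *)
Definition tight_edge s t := [/\ deg s = 3, deg t = 3, i s t = i t s, i s t != 0 &
  (forall p, adj s p -> p != t -> adj t p /\ i s p = - i s t / 2) /\
  (forall p, adj t p -> p != s -> adj s p /\ i t p = - i t s / 2)].

Lemma chain_end_near s t t1 h1 : chain_end i s t t1 h1 -> (2 < deg t1)%N -> t1 = s /\ h1 = t.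
Proof. by case/chain_end_tail => [[-> ->]//|->]. Qed.

Lemma edge_gain_tight s t t1 h1 t2 h2 (c : G -> R) :
  adj s t -> unit_current_potential s t c -> (i s t + i t s) ^+ 2 = 1 ->
  chain_end i s t t1 h1 -> chain_end i t s t2 h2 -> ~ acyclic_edge R (s, t) ->
  4 * pair_gain i h1 h2 <= edge_cycle s t c s t -> [/\ h1 = t, h2 = s & tight_edge t s].
Proof.
move=> st hc fl c1 c2 nac tight; have co := edge_cycle_circulation st hc.
have bp := chain_branch_pair co c1 c2 fl nac.
have E := energy_edge_cycle st hc; have K0 := edge_cycle_pos st hc nac.
case: (bp_tails bp) => [[t1E t2E]|[dt1 dt2]]; last first.
  by have := single_far co te_conserved bp E K0 dt1 dt2; rewrite ltNge tight.
have := single_tight co te_conserved bp E K0 t1E t2E tight.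
have [|_ ->] := chain_end_near c1; first by rewrite t1E (chain_end_deg c2).
by have [|_ ->] := chain_end_near c2; first by rewrite t2E (chain_end_deg c1).
Qed.

Lemma tight_edge_sym s t : tight_edge s t -> tight_edge t s.
Proof. by case=> ds dt st nz [f1 f2]; split=> //; rewrite -st. Qed.

(** Equal currents that meet at p have to leave it along a third edge. *)
Lemma merging_gain p s t : adj p s -> adj p t -> s != t ->
  i p s = i p t -> i p s != 0 -> 0 < vertex_gain i p.
Proof.
move=> ps pt st E nz; have i0 := te_conserved.
have d3 : (2 < deg p)%N.
  have := deg_gt0 ps; case dp : (deg p) => [|[|[|d]]] // _; case/eqP: nz.
    exact: deg1_zero i0 dp ps.
  by have := deg2_sum i0 dp pt ps st; lra.
have dR := degR R d3; rewrite vertex_gainE // divr_gt0 //; last first.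
  by rewrite addr_gt0 // divr_gt0 //; lra.
apply: lt_le_trans (sqr_at_ge _ ps).
by rewrite lt_neqAle sqr_ge0 eq_sym sqrf_eq0 nz.
Qed.

Lemma tight_edge_nbrs s t p : tight_edge s t -> adj s t -> t \in [:: u; v; w; z] ->
  (forall q, q \notin [:: u; v; w; z] -> vertex_gain i q <= 0) ->
  adj s p -> p \in [:: u; v; w; z].
Proof.
case=> _ _ st nz [f1 f2] ast tL g0 sp; apply: contraT => pL.
have pE q : adj p q -> i p q = - i q p.
  move=> pq; have [_ i1] := te_midpoint; move: pL; rewrite !inE !negb_or.
  case/and4P=> pu pv pw pz; have := i1 p q pq.
  rewrite /edge_ind (negPf pu) (negPf pv) (negPf pw) (negPf pz) !addr0 subrr.
  by move/eqP; rewrite addr_eq0 => /eqP.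
have pt : p != t by apply: contraNneq pL => ->.
have [tp isp] := f1 p sp pt; have ps : adj p s by rewrite adj_sym.
have pt' : adj p t by rewrite adj_sym.
have [_ itp] := f2 p tp (adj_neq ps).
have := g0 p pL; rewrite leNgt => /negP[].
apply: (merging_gain ps pt' (adj_neq ast)); rewrite !pE // isp ?itp ?st //.
by rewrite mulNr opprK mulf_neq0 -?st ?invr_eq0 ?pnatr_eq0.
Qed.

(** The chains of the two edges have no common end, so that their gains add up. *)
Lemma disjoint_le h1 h2 h3 h4 t1 t2 t3 t4 :
  chain_end i u v t1 h1 -> chain_end i v u t2 h2 ->
  chain_end i w z t3 h3 -> chain_end i z w t4 h4 ->
  ~ acyclic_edge R (u, v) -> ~ acyclic_edge R (w, z) ->
  h1 != h3 -> h1 != h4 -> h2 != h3 -> h2 != h4 ->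
  eff_res R e f <= res_diam R G /\
  (res_diam R G <= eff_res R e f -> uniq [:: u; v; w; z] /\
   forall s, s \in [:: u; v; w; z] ->
     deg s = 3 /\ forall p, adj s p -> p \in [:: u; v; w; z]).
Proof.
move=> c1 c2 c3 c4 nace nacf n13 n14 n23 n24; have i0 := te_conserved.
have [a ha] := @potential_exists R G u v Gc; have [b hb] := @potential_exists R G w z Gc.
have := compare_drop_uv Gc uv wz (te_neq te) (te_pot te) ha hb (te_e te) (te_f te).
have := normr_ge0 (m u - m v); rewrite -/i => dr cmp.
have ge := edge_gain uv ha te_flow_e c1 c2 nace; have gf := edge_gain wz hb te_flow_f c3 c4 nacf.
have disj : ~~ has (mem (undup [:: h1; h2])) (undup [:: h3; h4]).
  apply/hasPn => h; rewrite mem_undup => hh; apply: (introN idP).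
  change (h \in undup [:: h1; h2] -> False); move: hh; rewrite mem_undup !inE.
  by move=> /orP[]/eqP -> /orP[]/eqP E; move: n13 n14 n23 n24; rewrite E eqxx.
have uq : uniq (undup [:: h1; h2] ++ undup [:: h3; h4]).
  by rewrite cat_uniq !undup_uniq disj.
have g2 : pair_gain i h1 h2 + pair_gain i h3 h4 <= gain i.
  by have := gain_ge i0 uq; rewrite big_cat.
split=> [|eqD]; first by lra.
have te4 : 4 * pair_gain i h1 h2 <= edge_cycle u v a u v by lra.
have tf4 : 4 * pair_gain i h3 h4 <= edge_cycle w z b w z by lra.
have g0 q : q \notin [:: h1; h2; h3; h4] -> vertex_gain i q <= 0.
  move=> qn; have uq' : uniq (q :: undup [:: h1; h2] ++ undup [:: h3; h4]).
    rewrite cons_uniq uq andbT mem_cat !mem_undup; apply: contra qn.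
    by rewrite !inE => /orP[/orP[]|/orP[]] ->; rewrite ?orbT.
  have := gain_ge i0 uq'; rewrite big_cons big_cat /= => k.
  by rewrite /pair_gain in te4 tf4 ge gf; lra.
have [h1E h2E Te] := edge_gain_tight uv ha te_flow_e c1 c2 nace te4.
have [h3E h4E Tf] := edge_gain_tight wz hb te_flow_f c3 c4 nacf tf4.
rewrite h1E h2E h3E h4E in n13 n14 n23 n24 g0.
have g0' q : q \notin [:: u; v; w; z] -> vertex_gain i q <= 0.
  move=> qn; apply: g0; apply: contra qn; rewrite !inE.
  by case/or4P => ->; rewrite ?orbT.
have vu : adj v u by rewrite adj_sym.
have zw : adj z w by rewrite adj_sym.
split.
  rewrite /= !inE !negb_or (adj_neq uv) (adj_neq wz) !andbT n23 n24 n13 n14.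
  by [].
move=> s; rewrite !inE => /or4P[]/eqP ->; split.
- by case: Te.
- by move=> p; apply: (tight_edge_nbrs (tight_edge_sym Te) uv) => //; rewrite !inE eqxx ?orbT.
- by case: Te.
- by move=> p; apply: (tight_edge_nbrs Te vu) => //; rewrite !inE eqxx ?orbT.
- by case: Tf.
- by move=> p; apply: (tight_edge_nbrs (tight_edge_sym Tf) wz) => //; rewrite !inE eqxx ?orbT.
- by case: Tf.
- by move=> p; apply: (tight_edge_nbrs Tf zw) => //; rewrite !inE eqxx ?orbT.
Qed.

(** The chains have a common end P. The circulation that is the difference of
    the two edge cycles, read as current into P, is x along the first chain and y
    along the second. If one of these has the wrong sign, the energy x + y is
    below that of a single edge cycle. *)
Lemma meet_strict t1 t2 t3 t4 P Q Q' :
  chain_end i u v t1 P -> chain_end i v u t2 Q ->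
  chain_end i z w t4 P -> chain_end i w z t3 Q' ->
  ~ acyclic_edge R (u, v) -> ~ acyclic_edge R (w, z) -> ~ parallel R (u, v) (w, z) ->
  eff_res R e f < res_diam R G.
Proof.
move=> c1 c2 c4 c3 nace nacf npar.
have [a ha] := @potential_exists R G u v Gc; have [b hb] := @potential_exists R G w z Gc.
have cmp := compare_pairing Gc uv wz (te_neq te) (te_pot te) ha hb (te_e te) (te_f te).
suff : energy (fun x y => edge_cycle u v a x y - edge_cycle w z b x y) < 4 * gain i.
  by move: cmp; rewrite -/i; lra.
have ca := edge_cycle_circulation uv ha; have cb := edge_cycle_circulation wz hb.
have i0 := te_conserved.
have Ke := edge_cycle_pos uv ha nace; have Kf := edge_cycle_pos wz hb nacf.
have ge := le_trans (edge_gain uv ha te_flow_e c1 c2 nace) (ler_wpM2l (ler0n R 4) (pair_gain_le P Q i0)).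
have gf := le_trans (edge_gain wz hb te_flow_f c3 c4 nacf) (ler_wpM2l (ler0n R 4) (pair_gain_le Q' P i0)).
have := energyB uv wz ha hb; have := circulationB ca cb; set om := fun x y => _ => co /= E.
have T : edge_cycle u v a w z = edge_cycle w z b u v.
  by rewrite (edge_cycle_uv_wz _ uv (te_neq te)) (edge_cycle_wz_uv _ (te_neq te)) (reciprocity ha hb).
have ouv : om u v = edge_cycle u v a u v - edge_cycle w z b u v by [].
have owz : om w z = edge_cycle u v a w z - edge_cycle w z b w z by [].
have [x0|x0] := leP (om u v) 0; first by rewrite E; lra.
have [y0|y0] := leP 0 (om w z); first by rewrite E; lra.
have bp1 := chain_branch_pair co c1 c2 te_flow_e nace.
have bp2 := branch_pair_rev (chain_branch_pair co c3 c4 te_flow_f nacf).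
have ag1 := chain_end_circulation c1; have ag2 := chain_end_circulation c2.
have ag3 := chain_end_circulation c3; have ag4 := chain_end_circulation c4.
have t14 : t1 != t4.
  apply/eqP => t14; apply: npar; right => o oc.
  by rewrite (ag1 o oc) t14 -(ag4 o oc).
have t24 : Q = P -> t2 != t4.
  move=> QP; apply/eqP => t24; apply: npar; left => o oc /=.
  have := ag2 o oc; rewrite QP t24 -(ag4 o oc) /= (oc.1 u v) (oc.1 w z).
  exact: oppr_inj.
have t13 : Q' = P -> t1 != t3.
  move=> QP; apply/eqP => t13; apply: npar; left => o oc /=.
  by rewrite (ag3 o oc) QP -t13 -(ag1 o oc).
have t23 : Q = Q' -> t2 != t3.
  move=> QQ; apply/eqP => t23; apply: npar; right => o oc /=.
  rewrite (oc.1 w z); have := ag3 o oc; rewrite /= -QQ -t23 => ->.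
  by have := ag2 o oc; rewrite /= => <-; rewrite oc.1.
have y1 : 0 < - om w z by lra.
have [QP|QP] := eqVneq Q P; have [Q'P|Q'P] := eqVneq Q' P.
- have n24 := t24 QP; have n13 := t13 Q'P; have n23 := t23 (etrans QP (esym Q'P)).
  rewrite E; rewrite QP in bp1; rewrite Q'P in bp2.
  exact: (shared_loops co i0 E x0 y1 t14 bp1 bp2).
- by rewrite E; exact: (shared_loop co i0 E x0 y1 t14 bp1 bp2 QP Q'P (t24 QP)).
- have E' : energy om = - om w z + om u v by rewrite E addrC.
  have t41 : t4 != t1 by rewrite eq_sym.
  have t31 : t3 != t1 by rewrite eq_sym t13.
  by rewrite E'; exact: (shared_loop co i0 E' y1 x0 t41 bp2 bp1 Q'P QP t31).
have [QQ|QQ] := eqVneq Q Q'.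
  by rewrite E; exact: (shared_both co i0 E x0 y1 t14 bp1 bp2 QQ QP (t23 QQ)).
by rewrite E; exact: (shared_distinct co i0 E x0 y1 t14 bp1 bp2 QP Q'P QQ).
Qed.

(** The ends of an edge have positive resistance. *)
Lemma edge_cycle_lt1 s t (c : G -> R) : adj s t -> unit_current_potential s t c ->
  edge_cycle s t c s t < 1.
Proof.
move=> st hc; have E := energy_edge_cycle st hc; have co := edge_cycle_circulation st hc.
have := energy_ge_sqr_at s co.1; rewrite E.
have := @rest_ge_card _ _ (edge_cycle s t c) s [:: t] (co.2 s) isT.
rewrite /= st big_seq1 => /(_ isT); rewrite rest0 (@rest_cons _ _ _ s t [::] st isT).
set K := edge_cycle _ _ _ _ _; set r := rest _ _ _ => k1 k2.
have d1 : 1 <= (deg s)%:R :> R by rewrite ler1n; exact: deg_gt0 st.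
have r0 : 0 <= r by exact: rest_ge0.
rewrite ltNge; apply/negP => K1.
have KK : K <= K ^+ 2 by rewrite expr2 ler_peMl //; lra.
have r00 : r = 0 by lra.
by move: k1; rewrite r00 mulr0; lra.
Qed.

(** All the current crosses a bridge in one direction, so one end of the bridge
    is farther from the other edge than its midpoint. *)
Lemma acyclic_drop p q r s (n c : G -> R) : adj p q -> adj r s ->
  [set p; q]%SET != [set r; s]%SET ->
  averaged_potential p q r s n -> unit_current_potential p q c ->
  acyclic_edge R (p, q) -> edge_cycle p q c p q = 0 /\ `|n p - n q| = 2^-1.
Proof.
move=> pq rs ne hn hc ac; have co := edge_cycle_circulation pq hc.
have K0 : edge_cycle p q c p q = 0 by exact: ac _ co.
split=> //.
have z0 x y : adj x y -> edge_cycle p q c x y = 0.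
  by apply: energy_le0 co.1 _; rewrite (energy_edge_cycle pq hc) K0.
have cpq : c p - c q = 1 by move: K0; rewrite edge_cycle_self //; lra.
have crs : c r = c s.
  by have := z0 _ _ rs; rewrite (edge_cycle_uv_wz _ pq ne); lra.
have cl : closed (@adj G) [pred t | (c t == c p) || (c t == c q)].
  apply: intro_closed; first by apply: sym_connect_sym; exact: adj_sym.
  move=> x y xy; have := z0 _ _ xy; rewrite /edge_cycle !inE.
  case: andP => [[/eqP -> /eqP ->]|_]; first by rewrite !eqxx orbT.
  case: andP => [[/eqP -> /eqP ->]|_]; first by rewrite !eqxx.
  by rewrite subrr sub0r => /eqP; rewrite oppr_eq0 subr_eq0 => /eqP ->.
have := closed_connect cl (Gc p r); rewrite !inE eqxx /=.
rewrite (drop_uv hn hc) -crs => /esym/orP[]/eqP ->.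
  by rewrite (_ : _ / 2 = - 2^-1) ?normrN ?ger0_norm ?invr_ge0 //; lra.
by rewrite (_ : _ / 2 = 2^-1) ?ger0_norm ?invr_ge0 //; lra.
Qed.

Lemma acyclic_strict : acyclic_edge R (u, v) \/ acyclic_edge R (w, z) ->
  eff_res R e f < res_diam R G.
Proof.
have [a ha] := @potential_exists R G u v Gc; have [b hb] := @potential_exists R G w z Gc.
have ne := te_neq te; have hm := te_pot te.
have Ke := edge_cycle_lt1 uv ha; have Kf := edge_cycle_lt1 wz hb.
have g0 := gain_ge0 te_conserved.
case=> ac.
  have [K0 dr] := acyclic_drop uv wz ne hm ha ac.
  have := compare_drop_uv Gc uv wz ne hm ha hb (te_e te) (te_f te).
  by rewrite -/i dr K0; lra.
have ne' : [set w; z]%SET != [set u; v]%SET by rewrite eq_sym.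
have hm' : averaged_potential w z u v (fun t => - m t).
  move=> x; have := laplacian_lin (fun=> 0) m m (-1) 0 x.
  rewrite (_ : laplacian (fun t => 0 + -1 * m t + 0 * m t) x = laplacian (fun t => - m t) x).
    move=> ->; rewrite hm (_ : laplacian (fun=> 0) x = 0); first by field.
    by rewrite /laplacian big1 // => y _; rewrite subrr.
  by rewrite /laplacian; apply: eq_bigr => y _; ring.
have [K0 dr] := acyclic_drop wz uv ne' hm' hb ac.
have := compare_drop_wz Gc uv wz ne hm ha hb (te_e te) (te_f te).
have -> : m w - m z = - (- m w - - m z) by ring.
by rewrite normrN dr K0 -/i; lra.
Qed.

(** Two edges on a common chain: moving both by half an edge costs nothing. *)
Lemma parallel_gain : parallel R (u, v) (w, z) -> eff_res R e f + gain i <= res_diam R G.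
Proof.
have [a ha] := @potential_exists R G u v Gc; have [b hb] := @potential_exists R G w z Gc.
case=> ag.
  have co := circulationB (edge_cycle_circulation uv ha) (edge_cycle_circulation wz hb).
  have := compare_pairing Gc uv wz (te_neq te) (te_pot te) ha hb (te_e te) (te_f te).
  by rewrite (energyB uv wz ha hb); have := ag _ co; rewrite -/i /=; lra.
have te' := two_edges_rev2 te; have hb' := unit_current_rev hb.
have zw := te_wz te'.
have co := circulationB (edge_cycle_circulation uv ha) (edge_cycle_circulation zw hb').
have := compare_pairing Gc uv zw (te_neq te') (te_pot te') ha hb' (te_e te') (te_f te').
rewrite (energyB uv zw ha hb') -(half_flow_swap u v w z m).2; have := ag _ co.
by rewrite -/i /=; lra.
Qed.

(** Equality makes the current leave e and enter f on both sides, since the bonus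
    for a lopsided current would be too large. Without gain the current meets
    vertices of degree 2 only, and from these it runs on to all their neighbours,
    hence through all of G. *)
Lemma no_gain_cycle : gain i <= 0 -> res_diam R G <= eff_res R e f -> forall x, deg x = 2.
Proof.
move=> g0 eqD; have i0 := te_conserved.
have gain0 x : vertex_gain i x <= 0.
  by have := @gain_ge _ _ i [:: x] i0 isT; rewrite big_seq1; lra.
have gE := gain_ge0 i0.
have [a ha] := @potential_exists R G u v Gc; have [b hb] := @potential_exists R G w z Gc.
have ne := te_neq te; have hm := te_pot te.
have Ke := edge_cycle_lt1 uv ha; have Kf := edge_cycle_lt1 wz hb.
have := compare_drop_uv Gc uv wz ne hm ha hb (te_e te) (te_f te).
have := compare_drop_wz Gc uv wz ne hm ha hb (te_e te) (te_f te); rewrite -/i => kf ke.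
have : `|m u - m v| < 2^-1 by lra.
have : `|m w - m z| < 2^-1 by lra.
rewrite !ltr_norml => /andP[f1 f2] /andP[e1 e2] {ke kf}.
have [_ i1] := te_midpoint.
have wne : [set w; z]%SET != [set u; v]%SET by rewrite eq_sym.
have [a1 a2 a3 a4] := edge_ind_uv R uv ne; have [b1 b2 b3 b4] := edge_ind_uv R wz wne.
have nz x y : adj x y -> i x y != 0 -> i y x != 0.
  move=> xy; have yx : adj y x by rewrite adj_sym.
  have [[-> ->]|n1] := pselect ((x, y) = (u, v)).
    by move=> _; rewrite /i /half_flow a2 a4; apply/eqP; lra.
  have [[-> ->]|n2] := pselect ((x, y) = (v, u)).
    by move=> _; rewrite /i /half_flow a1 a3; apply/eqP; lra.
  have [[-> ->]|n3] := pselect ((x, y) = (w, z)).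
    by move=> _; rewrite /i /half_flow b2 b4; apply/eqP; lra.
  have [[-> ->]|n4] := pselect ((x, y) = (z, w)).
    by move=> _; rewrite /i /half_flow b1 b3; apply/eqP; lra.
  have := i1 x y xy; rewrite !edge_ind_eq0 // subrr => /eqP.
  by rewrite addr_eq0 => /eqP ->; rewrite oppr_eq0.
have deg2 x : sqr_at i x != 0 -> deg x = 2.
  move=> sx; have := gain0 x; have := sqr_at_ge0 i x => s0.
  case dx : (deg x) => [|[|[|d]]] //.
  - by case/eqP: sx; apply: big1 => y /deg_gt0; rewrite dx.
  - case/eqP: sx; apply: big1 => y xy; by rewrite (deg1_zero i0 dx xy) expr0n.
  - have d3 : (2 < deg x)%N by rewrite dx.
    rewrite vertex_gainE // pmulr_lle0; last first.
      by have := degR R d3 => dR; rewrite invr_gt0 addr_gt0 // divr_gt0 //; lra.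
    by move=> s1; case/eqP: sx; apply/eqP; rewrite eq_le s1.
have cl : closed (@adj G) [pred x | sqr_at i x != 0].
  apply: intro_closed; first by apply: sym_connect_sym; exact: adj_sym.
  move=> x y xy; rewrite !inE => sx; have d2 := deg2 x sx.
  have ixy : i x y != 0.
    apply: contraNneq sx => z0; rewrite /sqr_at; apply/eqP; apply: big1 => t xt.
    have [->|ty] := eqVneq t y; first by rewrite z0 expr0n.
    by rewrite (deg2_sum i0 d2 xy xt ty) z0 oppr0 expr0n.
  have := nz x y xy ixy; have yx : adj y x by rewrite adj_sym.
  apply: contraNneq => s0; rewrite -sqrf_eq0 eq_le sqr_ge0 andbT -s0.
  exact: sqr_at_ge.
move=> x; apply: deg2; have := closed_connect cl (Gc u x); rewrite !inE => <-.
have : i u v != 0 by rewrite /i /half_flow a1 a3; apply/eqP; lra.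
apply: contraNneq => s0; rewrite -sqrf_eq0 eq_le sqr_ge0 andbT -s0.
exact: sqr_at_ge.
Qed.

End Fixed.

Lemma two_edges_le u v w z m e f : two_edges u v w z m e f ->
  eff_res R e f <= res_diam R G /\
  (res_diam R G <= eff_res R e f -> (forall x : G, deg x = 2) \/
    uniq [:: u; v; w; z] /\ forall s, s \in [:: u; v; w; z] ->
      deg s = 3 /\ forall p, adj s p -> p \in [:: u; v; w; z]).
Proof.
move=> te; pose i := half_flow u v w z m.
have uv := te_uv te; have wz := te_wz te.
have vu : adj v u by rewrite adj_sym.
have zw : adj z w by rewrite adj_sym.
set goal := _ /\ _.
have strict : eff_res R e f < res_diam R G -> goal.
  by move=> lt; split; [exact: ltW | rewrite leNgt lt].
have [ac|nac] := pselect (acyclic_edge R (u, v) \/ acyclic_edge R (w, z)).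
  by apply: strict; exact: acyclic_strict te ac.
have nace : ~ acyclic_edge R (u, v) by move=> ac; apply: nac; left.
have nacf : ~ acyclic_edge R (w, z) by move=> ac; apply: nac; right.
have nace' : ~ acyclic_edge R (v, u) by move=> /acyclic_edge_rev.
have nacf' : ~ acyclic_edge R (z, w) by move=> /acyclic_edge_rev.
have [par|npar] := pselect (parallel R (u, v) (w, z)).
  have le := parallel_gain te par; have i0 := te_conserved te.
  have g0 := gain_ge0 i0.
  rewrite -/i in le; split=> [|eqD]; first by lra.
  by left; apply: (no_gain_cycle te) => //; rewrite -/i; lra.
have npar1 : ~ parallel R (v, u) (w, z) by move=> /parallel_rev1.
have npar2 : ~ parallel R (w, z) (u, v) by move=> /parallel_sym.
have npar3 : ~ parallel R (z, w) (u, v) by move=> /parallel_rev1/parallel_sym.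
have mf := te_midpoint te; have mf' := midpoint_flow_neg mf.
have [t1 [h1 c1]] := chain_end_exists Gc uv wz mf nace npar.
have [t2 [h2 c2]] := chain_end_exists Gc vu wz (midpoint_flow_rev1 mf) nace' npar1.
have [t3 [h3 /chain_end_neg c3]] := chain_end_exists Gc wz uv mf' nacf npar2.
have [t4 [h4 /chain_end_neg c4]] :=
  chain_end_exists Gc zw uv (midpoint_flow_rev1 mf') nacf' npar3.
have te1 := two_edges_rev1 te; have te2 := two_edges_rev2 te.
have te12 := two_edges_rev2 te1.
have i1 := (half_flow_swap u v w z m).1; have i2 := (half_flow_swap u v w z m).2.
have i12 := (half_flow_swap v u w z m).2; rewrite -i1 in i12.
have npar4 : ~ parallel R (u, v) (z, w) by move=> /parallel_sym.
have npar5 : ~ parallel R (v, u) (z, w) by move=> /parallel_rev1.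
have [E|n14] := eqVneq h1 h4.
  by apply: strict; rewrite -E in c4; exact: (meet_strict te c1 c2 c4 c3).
have [E|n13] := eqVneq h1 h3.
  apply: strict; rewrite -E in c3; rewrite i2 in c1 c2 c3 c4.
  exact: (meet_strict te2 c1 c2 c3 c4).
have [E|n24] := eqVneq h2 h4.
  apply: strict; rewrite -E in c4; rewrite i1 in c1 c2 c3 c4.
  exact: (meet_strict te1 c2 c1 c4 c3).
have [E|n23] := eqVneq h2 h3.
  apply: strict; rewrite -E in c3; rewrite i12 in c1 c2 c3 c4.
  exact: (meet_strict te12 c2 c1 c3 c4).
have [le eqK] := disjoint_le te c1 c2 c3 c4 nace nacf n13 n14 n23 n24.
by split=> // /eqK; right.
Qed.

Lemma averaged_potential_exists u v w z : exists m, averaged_potential (R := R) u v w z m.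
Proof.
have [p hp] := @potential_exists R G u w Gc; have [q hq] := @potential_exists R G v z Gc.
exists (fun t => 0 + 2^-1 * p t + 2^-1 * q t) => x.
rewrite (laplacian_lin (fun=> 0)) {2}/laplacian hp {2}/laplacian hq.
have -> : laplacian (fun=> 0) x = 0 :> R.
  by rewrite /laplacian big1 // => y _; rewrite subrr.
by field.
Qed.

End Compare.

(** * The extremal graphs *)

Section Recognition.
Variable G : sgraph.
Implicit Types x y z : G.

Lemma isomorphic_of_param (H : sgraph) (g : H -> G) : injective g ->
  (forall x, exists i, g i = x) -> (forall i j, adj (g i) (g j) = adj i j) ->
  isomorphic G H.
Proof.
move=> gi gs ga.
have ex x : exists i, g i == x by have [i <-] := gs x; exists i.
pose f x := xchoose (ex x).
have gK x : g (f x) = x by apply/eqP; exact: xchooseP (ex x).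
exists f; split; last by move=> x y; rewrite -ga !gK.
by exists g => // i; apply: gi; rewrite gK.
Qed.

Lemma complete4_recognition u (L : seq G) : connected_graph G -> uniq L ->
  size L = 4 -> u \in L ->
  (forall s, s \in L -> deg s = 3 /\ forall p, adj s p -> p \in L) ->
  isomorphic G (complete_graph 4).
Proof.
move=> Gc uq sz uL hL.
have adjL s p : s \in L -> p \in L -> adj s p = (s != p).
  move=> sL pL; have [ds nb] := hL s sL.
  apply/idP/idP => [|sp]; first exact: adj_neq.
  have sub : @adj G s \subset [predD1 L & s].
    apply/subsetP => q sq; rewrite !inE; have sq' : adj s q by exact: sq.
    by rewrite (nb q sq') eq_sym (adj_neq sq').
  have c3 : #|[predD1 L & s]| = 3.
    by have := cardD1 s (mem L); rewrite (card_uniqP uq) sz sL /= add1n => -[<-].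
  have := subset_cardP (etrans ds (esym c3)) sub => /(_ p).
  by rewrite !inE eq_sym sp pL => pE; exact: pE.
have all_in x : x \in L.
  have cl : closed (@adj G) (mem L).
    apply: intro_closed; first by apply: sym_connect_sym; exact: adj_sym.
    by move=> s p sp sL; have [_ nb] := hL s sL; exact: nb.
  by have := closed_connect cl (Gc u x); rewrite uL => <-.
apply: (@isomorphic_of_param (complete_graph 4) (fun i : 'I_4 => nth u L i)).
- by move=> i j /eqP; rewrite nth_uniq ?sz // => /eqP/val_inj.
- move=> x; have xL := all_in x; have lt : (index x L < 4)%N by rewrite -index_mem sz in xL.
  by exists (Ordinal lt); rewrite nth_index // -index_mem sz.
- by move=> i j; rewrite adjL ?mem_nth ?nth_uniq ?sz.
Qed.

(** Walk through G until the first repetition. It repeats the starting vertex, as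
    any other vertex of the walk would get a third neighbour. *)
Lemma two_regular_recognition : connected_graph G -> (exists x y, adj x y) ->
  (forall x, deg x = 2) -> exists n, (3 <= n)%N /\ isomorphic G (cycle_graph n).
Proof.
move=> Gc [x0 [x1 x01]] d2.
pose D k := iter k (@chain_next G) (x0, x1); pose s k := (D k).1.
have D2 k : (D k).2 = s k.+1 by [].
have sadj k : adj (s k) (s k.+1).
  elim: k => [//|k IH]; have := chain_nextP (IH : adj (D k).1 (D k).2) (d2 _).
  by case/and4P.
have sne k : s k.+2 != s k.
  have := chain_nextP (sadj k : adj (D k).1 (D k).2) (d2 _).
  by case/and4P.
have snb k y : adj (s k.+1) y -> y = s k \/ y = s k.+2.
  have bk : adj (s k.+1) (s k) by rewrite adj_sym.
  have [t [_ _ tP]] := deg2P (d2 _) bk.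
  have [E|->] := tP _ (sadj k.+1); last exact: tP.
  by have := sne k; rewrite E eqxx.
pose repeats n := [exists j : 'I_n, s j == s n].
have exn : exists n, repeats n.
  apply: contrapT => no; have inj : injective (fun i : 'I_#|G|.+1 => s i).
    have lt i j : (i < j)%N -> s i != s j.
      move=> ij; apply/eqP => E; apply: no; exists j; apply/existsP.
      by exists (Ordinal ij); rewrite /= E.
    move=> i j E; apply: val_inj; case: (ltngtP i j) => // /lt; rewrite E eqxx //.
  by have := leq_card _ inj; rewrite card_ord ltnn.
have [n /existsP[[j0 jn] /= /eqP sj0] nmin] := ex_minnP exn.
have inj i j : (i < n)%N -> (j < n)%N -> s i = s j -> i = j.
  have lt a b : (a < b)%N -> (b < n)%N -> s a != s b.
    move=> ab bn; apply/negP => E; have := nmin b; rewrite leqNgt bn => /(_ _)/negP.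
    by apply=> //; apply/existsP; exists (Ordinal ab).
  move=> li lj E; case: (ltngtP i j) => // h; first by have := lt _ _ h lj; rewrite E eqxx.
  by have := lt _ _ h li; rewrite E eqxx.
have sn0 : s n = s 0.
  case: (posnP j0) => [j00|jp]; first by rewrite -sj0 j00.
  have an : adj (s n.-1) (s n) by have := sadj n.-1; rewrite (ltn_predK jn).
  move: an; rewrite -sj0 adj_sym -(prednK jp) => /snb[] E.
    have := inj _ _ _ _ E; rewrite (prednK jp) => h; have : n.-1 = j0.-1 by apply: h; lia.
    lia.
  rewrite (prednK jp) in E; have [jn1|jn1] := ltnP j0.+1 n.
    have e : n.-1 = j0.+1 by apply: inj E; lia.
    have := sne j0; have -> : j0.+2 = n by lia.
    by rewrite -sj0 eqxx.
  have e : n = j0.+1 by lia.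
  by have := sadj j0; rewrite -e -sj0 adj_irrefl.
have n3 : (3 <= n)%N.
  have := sadj 0; have := sne 0; move: sn0 jn; case: (n) => [|[|[|k]]] //.
    by move=> -> _ _; rewrite adj_irrefl.
  by move=> -> _; rewrite eqxx.
have nb0 y : adj (s 0) y -> y = s n.-1 \/ y = s 1.
  have sb : s 1 <> s n.-1 by move/(inj _ _ _ _) => h; have : 1%N = n.-1 by [apply: h; lia]; lia.
  rewrite -sn0; have -> : n = n.-1.+1 by lia.
  move=> /snb[->|->]; first by left.
  right; have : adj (s n.-1.+1) (s 1) by have -> : n.-1.+1 = n by [lia]; rewrite sn0.
  by case/snb => [/sb|->].
have nbr k y : (k < n)%N -> adj (s k) y ->
    exists2 l, (l < n)%N & y = s l /\ ((l == k.+1 %% n) || (k == l.+1 %% n))%N.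
  case: k => [|k] kn.
    move=> /nb0[->|->]; [exists n.-1 | exists 1%N]; rewrite ?(ltn_predK kn); try lia.
      by split=> //; rewrite modnn eqxx orbT.
    by split=> //; rewrite modn_small ?eqxx //; lia.
  move=> /snb[->|->].
    by exists k; [lia | split=> //; rewrite (modn_small kn) eqxx orbT].
  have [kn2|kn2] := ltnP k.+2 n.
    by exists k.+2 => //; split=> //; rewrite modn_small ?eqxx.
  have e : n = k.+2 by lia.
  by exists 0%N; [lia | split; rewrite -?sn0 ?e // modnn eqxx].
exists n; split=> //.
apply: (@isomorphic_of_param (cycle_graph n) (fun i : 'I_n => s i)).
- by move=> i j /inj E; apply: val_inj; exact: E.
- move=> x.
  have cl : closed (@adj G) [pred y | [exists i : 'I_n, s i == y]].
    apply: intro_closed; first by apply: sym_connect_sym; exact: adj_sym.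
    move=> y t yt; rewrite !inE => /existsP[k /eqP ky]; rewrite -ky in yt.
    have [l ln [tl _]] := nbr _ _ (ltn_ord k) yt.
    by apply/existsP; exists (Ordinal ln); rewrite /= tl.
  have := closed_connect cl (Gc (s 0) x); rewrite !inE.
  have -> : [exists i : 'I_n, s i == s 0].
    by apply/existsP; exists (Ordinal (leq_trans (isT : 0 < 3)%N n3)).
  by move=> /esym/existsP[i /eqP <-]; exists i.
- have succ k l : (k < n)%N -> l = (k.+1 %% n)%N -> adj (s k) (s l).
    move=> kn ->; have [kn1|kn1] := ltnP k.+1 n; first by rewrite modn_small.
    have e : k.+1 = n by lia.
    by rewrite e modnn -sn0 -e.
  move=> i j; rewrite /= /cycle_adj; apply/idP/andP => [ij|[_ /orP[]/eqP E]].
  + split; first by apply: contraTneq ij => ->; rewrite adj_irrefl.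
    have [l ln [jl h]] := nbr _ _ (ltn_ord i) ij.
    by rewrite (inj _ _ (ltn_ord j) ln jl).
  + exact: succ.
  + by rewrite adj_sym; exact: succ.
Qed.

End Recognition.

Section Converse.
Variable R : realType.

Lemma isomorphic_diam_le (G H : sgraph) : connected_graph G -> connected_graph H ->
  isomorphic G H -> forall x0 : G, res_diam R G <= res_diam R H.
Proof.
move=> Gc Hc [f [[g fK gK] fa]] x0.
have [x [y ->]] := res_diam_attained R x0 Gc.
have [v hv] := @potential_exists R H (f x) (f y) Hc.
have hv' : unit_current_potential x y (v \o f).
  move=> z; have := hv (f z); rewrite !(inj_eq (can_inj fK)) => <-.
  rewrite (reindex f) /=; last by exists g => t _; rewrite ?fK ?gK.
  by apply: eq_bigl => t; rewrite fa.
rewrite (eff_res_potential Gc hv') /= -(eff_res_potential Hc hv).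
exact: eff_res_le_diam.
Qed.

(** A cycle is its own line graph: send each vertex to the edge that follows it. *)
Lemma cycle_line_graph (G : sgraph) n : (3 <= n)%N -> isomorphic G (cycle_graph n) ->
  isomorphic G (line_graph G).
Proof.
move=> n3 [f [[g fK gK] fa]].
pose S x := g (ordS (f x)).
have fS x : f (S x) = ordS (f x) by rewrite /S gK.
have fSv x : (f (S x) : nat) = ((f x).+1 %% n)%N by rewrite fS.
have modS (k : nat) : (k < n)%N -> (k.+1 %% n)%N = if k.+1 == n then 0%N else k.+1.
  move=> kn; case: eqP => [->|]; first by rewrite modnn.
  by move=> h; rewrite modn_small //; lia.
have Sx x : adj x (S x).
  rewrite -fa /= /cycle_adj fSv eqxx andbT; apply/eqP => E.
  have := fSv x; rewrite -E modS //; have := ltn_ord (f x).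
  by case: eqP; lia.
have adjE x y : adj x y -> y = S x \/ x = S y.
  rewrite -fa /= /cycle_adj => /andP[_ /orP[]/eqP E]; [left | right];
    by apply: (can_inj fK); apply: val_inj; rewrite /= fSv.
have Sinj : injective S.
  move=> x y E; have := fSv x; rewrite E fSv !modS // => E'.
  apply: (can_inj fK); apply: val_inj => /=; move: E' (ltn_ord (f x)) (ltn_ord (f y)).
  by do 2!case: eqP; lia.
have SS x : S (S x) <> x.
  move=> E; have := fSv (S x); rewrite E fSv !modS //; last first.
    by have := ltn_ord (f x); case: eqP; lia.
  by have := ltn_ord (f x); do 2![case: eqP => /=]; lia.
have edgeS x : exists e : line_vertex G, val e == [set x; S x]%SET.
  by have [e eE] := edge_vertex (Sx x); exists e; rewrite eE.
pose h x : line_vertex G := xchoose (edgeS x).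
have hE x : val (h x) = [set x; S x]%SET by apply/eqP; exact: xchooseP (edgeS x).
have hinj : injective h.
  move=> x y /(congr1 val); rewrite !hE => /set2_eq[[]//|[xy yx]].
  by case: (SS y); rewrite -xy.
have hsurj (e : line_vertex G) : exists x, h x = e.
  have [x [y [xy eE]]] := line_vertexP e.
  have [yE|xE] := adjE x y xy; [exists x | exists y]; apply: val_inj; rewrite hE eE.
    by rewrite yE.
  by rewrite xE setUC.
have exh e : exists x, h x == e by have [x <-] := hsurj e; exists x.
exists h; split.
  exists (fun e => xchoose (exh e)) => [x|e]; last by apply/eqP; exact: xchooseP (exh e).
  by apply: hinj; apply/eqP; exact: xchooseP (exh (h x)).
move=> x y; rewrite /= /line_adj (inj_eq hinj) !hE.
apply/andP/idP => [[xy /pred0Pn[t /andP[/= /set2P tx /set2P ty]]]|xy].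
  have [E|E] : y = S x \/ x = S y.
    case: tx => tx; case: ty => ty.
    - by case/eqP: xy; rewrite -tx.
    - by right; rewrite -tx.
    - by left; rewrite -tx.
    - by case/eqP: xy; apply: Sinj; rewrite -tx.
  - by rewrite E.
  - by rewrite E adj_sym.
split; first exact: adj_neq.
apply/pred0Pn; have [E|E] := adjE x y xy; [exists y | exists x];
  by rewrite /= -E !inE !eqxx ?orbT.
Qed.

(** Both diameters are 1/2 for K_4, realized in the line graph by two opposite
    edges. *)
Lemma complete4_diam (G : sgraph) : connected_graph G -> isomorphic G (complete_graph 4) ->
  res_diam R G <= res_diam R (line_graph G).
Proof.
move=> Gc [f [[g fK gK] fa]].
have adjE (x y : G) : adj x y = (x != y) by rewrite -fa /= /complete_adj (inj_eq (can_inj fK)).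
have sum_adj (x : G) (F : G -> R) : \sum_(y | adj x y) F y = \sum_y F y - F x.
  rewrite [X in _ = X - _](bigD1 x) //= addrAC subrr add0r.
  by apply: eq_bigl => y; rewrite adjE eq_sym.
have card4 : #|G| = 4 by rewrite (bij_eq_card (Bijective fK gK)); exact: (card_ord 4).
have half : res_diam R G <= 2^-1.
  have [x [y ->]] := res_diam_attained R (g ord0) Gc.
  have [->|xy] := eqVneq x y; first by rewrite eff_res_xx // invr_ge0.
  pose v z : R := ((z == x)%:R - (z == y)%:R) / 4.
  have hv : unit_current_potential x y v.
    move=> z; rewrite sum_adj subrr subr0 sumrB sumr_const.
    have -> : \sum_t v t = 0.
      rewrite -mulr_suml sumrB; have pick (s : G) : \sum_t (t == s)%:R = 1 :> R.
        by rewrite (bigD1 s) //= eqxx big1 ?addr0 // => t /negPf ->.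
      by rewrite !pick subrr mul0r.
    by rewrite card4 /v -mulr_natl; field.
  rewrite (eff_res_potential Gc hv) /v !eqxx (negPf xy) eq_sym (negPf xy) /=.
  by lra.
apply: le_trans half _.
have Lc := line_graph_connected Gc.
have [p [p_eq cover sum4]] : exists p : nat -> G,
    [/\ forall k l, (k < 4)%N -> (l < 4)%N -> (p k == p l) = (k == l),
        forall x, x = p 0 \/ x = p 1 \/ x = p 2 \/ x = p 3 &
        forall F : G -> R, \sum_x F x = F (p 0) + F (p 1) + F (p 2) + F (p 3)].
  pose p (k : nat) : G := g (inord k : 'I_4); exists p; split=> [k l k4 l4|x|F].
  - by rewrite (inj_eq (can_inj gK)) -val_eqE /= !inordK.
  - have : x = p (f x : 'I_4) by rewrite /p inord_val fK.
    by case: (f x : 'I_4) => [[|[|[|[|k]]]] //= _] ->; tauto.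
  - have -> : \sum_x F x = \sum_(k < 4) F (p k).
      rewrite (reindex g) /=; last by exists f => t _; rewrite ?fK ?gK.
      by apply: eq_bigr => k _; rewrite /p inord_val.
    by rewrite !big_ord_recr big_ord0 /= add0r.
have [e eE] : exists e : line_vertex G, val e = [set p 0; p 1]%SET.
  by apply: edge_vertex; rewrite adjE p_eq.
have [h hE] : exists h : line_vertex G, val h = [set p 2; p 3]%SET.
  by apply: edge_vertex; rewrite adjE p_eq.
pose eps x : R := if (x == p 0) || (x == p 1) then 1 else - 1.
have eps_sum : \sum_x eps x = 0 by rewrite sum4 /eps !p_eq //=; lra.
(* Each vertex contributes its sign, so that the potential is 1/4 on e, -1/4 on h
   and 0 on the edges between them. *)
pose phi (a : line_vertex G) : R := (\sum_(x in val a) eps x) / 8.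
have phiE a (x y : G) : adj x y -> val a = [set x; y]%SET -> phi a = (eps x + eps y) / 8.
  move=> xy aE; rewrite /phi aE (bigD1 x) ?inE ?eqxx //= (big_pred1 y) // => z.
  rewrite !inE; case: (eqVneq z x) => [->|zx] /=; last by rewrite andbT.
  by rewrite (negPf (adj_neq xy)).
have dartE (x y : G) : adj x y -> on_darts phi x y = (eps x + eps y) / 8.
  by move=> xy; have [a aE] := edge_vertex xy; rewrite (on_dartsE phi aE) (phiE a x y).
have hphi : unit_current_potential (G := line_graph G) e h phi.
  move=> a; have [x [y [xy aE]]] := line_vertexP a.
  rewrite -[LHS]/(laplacian (G := line_graph G) phi a) (laplacian_line_graph phi xy aE).
  rewrite (eq_bigr (fun z => (eps y - eps z) / 8)); last first.
    by move=> z xz; rewrite !dartE //; field.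
  rewrite [X in _ + X](eq_bigr (fun z => (eps x - eps z) / 8)); last first.
    by move=> z yz; rewrite !dartE //; field.
  rewrite !sum_adj -!mulr_suml !sumrB !sumr_const eps_sum card4.
  have -> : (a == e) = ([set x; y]%SET == [set p 0; p 1]%SET) by rewrite -aE -eE.
  have -> : (a == h) = ([set x; y]%SET == [set p 2; p 3]%SET) by rewrite -aE -hE.
  have pair s t : ([set x; y]%SET == [set s; t]%SET) =
      (((x == s) || (x == t)) && ((y == s) || (y == t))).
    apply/eqP/andP => [E|[/orP[]/eqP xs /orP[]/eqP yt]].
    - by have := set21 x y; have := set22 x y; rewrite E !inE => -> ->.
    - by have := adj_neq xy; rewrite xs yt eqxx.
    - by rewrite xs yt.
    - by rewrite xs yt setUC.
    - by have := adj_neq xy; rewrite xs yt eqxx.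
  have other s : ((s == p 2) || (s == p 3)) = ~~ ((s == p 0) || (s == p 1)).
    by case: (cover s) => [|[|[|]]] ->; rewrite !p_eq.
  rewrite !pair !other /eps.
  by case: (_ || _); case: (_ || _) => /=; lra.
have nhe : h != e.
  apply/eqP => he; have := set21 (p 0) (p 1); rewrite -eE -he hE !inE !p_eq //.
apply: le_trans (eff_res_le_diam R (e : line_graph G) h).
rewrite (eff_res_potential Lc hphi) (phiE e (p 0) (p 1)) ?adjE ?p_eq //.
rewrite (phiE h (p 2) (p 3)) ?adjE ?p_eq // /eps !p_eq //=.
by lra.
Qed.

End Converse.

Theorem theorem1p1 (R : realType) (G : sgraph)
    (Gconn : connected_graph G) (Gedge : exists x y : G, adj x y) :
  (res_diam R (line_graph G) <= res_diam R G)%R /\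
  (res_diam R (line_graph G) = res_diam R G <->
     (exists n : nat, (3 <= n)%N /\ isomorphic G (cycle_graph n)) \/
     isomorphic G (complete_graph 4)).
Proof.
have [x0 [x1 x01]] := Gedge.
have Lc := line_graph_connected Gconn.
have [e0 e0E] := edge_vertex x01.
have Dpos : 0 < res_diam R G.
  have [a ha] := @potential_exists R G x0 x1 Gconn.
  apply: lt_le_trans (eff_res_le_diam R x0 x1).
  rewrite (eff_res_potential Gconn ha).
  by have := edge_cycle_lt1 x01 ha; rewrite edge_cycle_self //; lra.
have [e [f DL]] := res_diam_attained R (e0 : line_graph G) Lc.
have [le eqD] : res_diam R (line_graph G) <= res_diam R G /\
    (res_diam R G <= res_diam R (line_graph G) ->
      (exists n : nat, (3 <= n)%N /\ isomorphic G (cycle_graph n)) \/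
      isomorphic G (complete_graph 4)).
  rewrite DL; have [->|ef] := eqVneq e f.
    by rewrite eff_res_xx //; split; [exact: ltW | rewrite leNgt Dpos].
  have [u [v [uv eE]]] := line_vertexP e; have [w [z [wz fE]]] := line_vertexP f.
  have ne : [set u; v]%SET != [set w; z]%SET.
    by apply: contraNneq ef; rewrite -eE -fE => /val_inj ->.
  have [m hm] := averaged_potential_exists R Gconn u v w z.
  have [le eqD] := two_edges_le Gconn (TwoEdges uv wz ne hm eE fE).
  split=> // /eqD[d2|[uq hL]]; [left | right].
    exact: two_regular_recognition Gconn Gedge d2.
  by apply: (complete4_recognition (u := u) Gconn uq _ _ hL); rewrite ?inE ?eqxx.
split=> //; split=> [E|]; first by apply: eqD; rewrite E.
move=> H; apply/eqP; rewrite eq_le le /=; case: H => [[n [n3 isoC]]|isoK].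
  exact: (isomorphic_diam_le R Gconn Lc (cycle_line_graph n3 isoC) x0).
exact: complete4_diam.
Qed.
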